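(* Let $d \in \{4, 6, 8, 10, 14, 26\}$, let $\ell$ be a $d$-satisfactory prime, and let $\alpha = \frac{a}{b} \in \mathbb{Q}$ (in lowest terms, $b>0$) with $\ell \nmid b$. If $r \in \mathbb{Z}$ satisfies $$\operatorname{ord}_{\ell}\left(\frac{24}{\gcd(d,24)}\, r + \frac{d}{\gcd(d,24)}\right) = 1,$$ then for all integers $n$ we have $$p_{\alpha}(\ell^2 n + r) \equiv 0 \pmod{\ell^{\operatorname{ord}_{\ell}(\alpha-d)}}.$$
   Context: For $\alpha \in \mathbb{Q}$, the rational numbers $p_\alpha(n)$ are defined by the formal power series identity $\sum_{n=0}^{\infty} p_\alpha(n) q^n = (q;q)_\infty^{\alpha}$, where $(q;q)_\infty = \prod_{n=1}^\infty (1-q^n)$ (the power is the one with constant term $1$), and $p_\alpha(n) := 0$ for $n<0$. Write $\alpha = a/b$ in lowest terms with $b>0$. For a prime $\ell \nmid b$, the numbers $p_\alpha(n)$ are $\ell$-integral (i.e. lie in $\mathbb{Z}_{(\ell)}$). For a prime $\ell$, $\operatorname{ord}_\ell$ denotes the $\ell$-adic valuation on $\mathbb{Q}$ (with $\operatorname{ord}_\ell(0)=+\infty$), and for an $\ell$-integral rational $x$, $x \equiv 0 \pmod{\ell^m}$ means $\operatorname{ord}_\ell(x) \ge m$. A prime $\ell$ is called $d$-satisfactory in the following cases: - for $d \in \{4, 8\}$: $\ell \equiv 5 \pmod 6$; - for $d = 14$: $\ell \equiv 5 \pmod 6$ and $\ell \neq 5$; - for $d \in \{6, 10\}$: $\ell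 \geq 7$ and $\ell \equiv 3 \pmod 4$; - for $d = 26$: $\ell \equiv 11 \pmod{12}$ and $\ell \neq 11$. *)

(* Defs.v *)
From mathcomp Require Import all_boot all_order all_algebra.
From mathcomp Require Import constructive_ereal.
From mathcomp Require Import ring.

Set Implicit Arguments.
Unset Strict Implicit.
Unset Printing Implicit Defensive.

Import Order.TTheory GRing.Theory Num.Theory.
Local Open Scope ring_scope.

(* A formal power series over rat is its coefficient
   sequence nat -> rat; equality of series is pointwise equality. *)

Definition fps_one (n : nat) : rat := (n == 0%N)%:R.

Definition fps_mul (f g : nat -> rat) (n : nat) : rat :=
  \sum_(i < n.+1) f i * g (n - i)%N.

Definition fps_exp (f : nat -> rat) (k : nat) : nat -> rat :=
  iter k (fps_mul f) fps_one.

Definition ffactr (x : rat) (k : nat) : rat := \prod_(i < k) (x - i%:R).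

Definition binr (x : rat) (k : nat) : rat := ffactr x k / k`!%:R.

(* For f with constant term 1, f^alpha = sum_k binr alpha k * (f - 1)^k.  As
   (f - 1)^k has no term of degree < k, only k <= n contributes to the
   coefficient of q^n.  The lemmas fps_powr_coef0, fps_powr_root_ge0 and
   fps_powr_root_le0 below say that f^(a/b) has constant term 1 and that its
   b-th power is f^a. *)
Definition fps_powr (f : nat -> rat) (alpha : rat) (n : nat) : rat :=
  \sum_(k < n.+1) binr alpha k * fps_exp (fun i => f i - fps_one i) k n.

(* (q; q)_oo: the factors 1 - q^k with k > n do not affect the coefficient
   of q^n, see qpochE. *)
Definition qpoch (n : nat) : rat :=
  (\prod_(1 <= k < n.+1) (1 - 'X^k) : {poly rat})`_n.

Definition p_ (alpha : rat) (n : int) : rat :=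
  if n is Posz m then fps_powr qpoch alpha m else 0.

Definition ord (l : nat) (x : rat) : \bar int :=
  if x == 0 then +oo%E
  else ((logn l `|numq x|)%:Z - (logn l `|denq x|)%:Z)%:E.

Definition satisfactory (d l : nat) : bool :=
  prime l &&
  [|| (d \in [:: 4; 8]%N) && (l %% 6 == 5)%N,
      [&& d == 14%N, (l %% 6 == 5)%N & l != 5%N],
      [&& d \in [:: 6; 10]%N, (7 <= l)%N & (l %% 4 == 3)%N]
    | [&& d == 26%N, (l %% 12 == 11)%N & l != 11%N]].

Definition fps_trunc (N : nat) (f : nat -> rat) : {poly rat} :=
  \poly_(i < N.+1) f i.

Lemma coef_trunc N f i : (i <= N)%N -> (fps_trunc N f)`_i = f i.
Proof. by move=> h; rewrite coef_poly ltnS h. Qed.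

Lemma eq_coefM N (p p' r r' : {poly rat}) :
  (forall i, (i <= N)%N -> p`_i = p'`_i) ->
  (forall i, (i <= N)%N -> r`_i = r'`_i) ->
  forall i, (i <= N)%N -> (p * r)`_i = (p' * r')`_i.
Proof.
move=> hp hr i hi; rewrite !coefM; apply: eq_bigr => j _.
by rewrite hp ?hr // (leq_trans _ hi) ?leq_subr // -ltnS.
Qed.

Lemma fps_mulE N f g i (p r : {poly rat}) :
  (forall i, (i <= N)%N -> f i = p`_i) ->
  (forall i, (i <= N)%N -> g i = r`_i) ->
  (i <= N)%N -> fps_mul f g i = (p * r)`_i.
Proof.
move=> hp hr hi; rewrite coefM; apply: eq_bigr => j _.
by rewrite hp ?hr // (leq_trans _ hi) ?leq_subr // -ltnS.
Qed.

Lemma fps_expE N f k i (p : {poly rat}) :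
  (forall i, (i <= N)%N -> f i = p`_i) ->
  (i <= N)%N -> fps_exp f k i = (p ^+ k)`_i.
Proof.
move=> hp; elim: k i => [|k IH] i hi; first by rewrite expr0 coef1.
by rewrite exprS; apply: (fps_mulE (N := N)).
Qed.

Lemma ffactrS x k : ffactr x k.+1 = ffactr x k * (x - k%:R).
Proof. by rewrite /ffactr big_ord_recr. Qed.

Lemma ffactrD x y n :
  ffactr (x + y) n
  = \sum_(i < n.+1) (ffactr x i * ffactr y (n - i)%N) *+ 'C(n, i).
Proof.
elim: n => [|n IH].
  by rewrite big_ord_recl big_ord0 /ffactr !big_ord0 mulr1 addr0.
rewrite ffactrS IH mulr_suml.
pose F i := (ffactr x i.+1 * ffactr y (n - i)%N) *+ 'C(n, i).
pose G i := (ffactr x i * ffactr y (n.+1 - i)%N) *+ 'C(n, i).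
transitivity (\sum_(i < n.+1) (F i + G i)).
  apply: eq_bigr => -[i /=]; rewrite ltnS => hi _.
  rewrite /F /G subSn // !ffactrS -mulrnDl mulrnAl; congr (_ *+ _).
  by rewrite natrB //; ring.
rewrite big_split /= [RHS]big_ord_recl /= bin0 addrC.
rewrite [X in X + _]big_ord_recl /= /G bin0 subn0 -addrA; congr (_ + _).
under [RHS]eq_bigr => i _ do rewrite /bump /= add1n binS subSS mulrnDr.
rewrite big_split /=; congr (_ + _).
rewrite [RHS]big_ord_recr /= bin_small // mulr0n addr0.
by apply: eq_bigr => i _; rewrite /bump /= add1n.
Qed.

Lemma binrD x y n :
  binr (x + y) n = \sum_(i < n.+1) binr x i * binr y (n - i)%N.
Proof.
have nz m : (m`!)%:R != 0 :> rat by rewrite pnatr_eq0 -lt0n fact_gt0.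
rewrite /binr ffactrD mulr_suml; apply: eq_bigr => -[i /=]; rewrite ltnS => hi _.
rewrite -mulr_natr -(bin_fact hi) !natrM.
have := nz i; have := nz (n - i)%N.
have : 'C(n, i)%:R != 0 :> rat by rewrite pnatr_eq0 -lt0n bin_gt0.
by move=> h1 h2 h3; field; rewrite h1 h2 h3.
Qed.

Lemma coef_exp_lt (G : {poly rat}) k i : G`_0 = 0 -> (i < k)%N -> (G ^+ k)`_i = 0.
Proof.
move=> G0; elim: k i => // k IH i; rewrite ltnS => hi.
rewrite exprS coefM big1 // => -[j hj] _ /=.
case: j hj => [|j] hj; first by rewrite G0 mul0r.
by rewrite IH ?mulr0 //; apply: leq_trans hi; rewrite ltn_subrL /=; case: (i) hj.
Qed.

Lemma coef_comp (p G : {poly rat}) N i : G`_0 = 0 -> (i <= N)%N ->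
  (p \Po G)`_i = \sum_(k < N.+1) p`_k * (G ^+ k)`_i.
Proof.
move=> G0 hi; rewrite coef_comp_poly.
pose F k := p`_k * (G ^+ k)`_i.
have ext m n : (m <= n)%N -> (forall k, (m <= k)%N -> F k = 0) ->
    \sum_(k < m) F k = \sum_(k < n) F k.
  move=> hmn h0; rewrite -!(big_mkord xpredT F) (big_cat_nat (leq0n m) hmn) /=.
  by rewrite [X in _ + X]big_nat_cond [X in _ + X]big1 ?addr0 // => k /andP[/andP[/h0]].
rewrite (ext _ (maxn (size p) N.+1)) ?leq_maxl //; last first.
  by move=> k hk; rewrite /F nth_default // mul0r.
rewrite -(ext N.+1) ?leq_maxr // => k hk.
by rewrite /F coef_exp_lt ?mulr0 // (leq_ltn_trans hi).
Qed.

Lemma fps_powrE N f alpha i : f 0%N = 1 -> (i <= N)%N ->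
  fps_powr f alpha i
  = (fps_trunc N (binr alpha) \Po fps_trunc N (fun i => f i - fps_one i))`_i.
Proof.
move=> f0 hi; rewrite (@coef_comp _ _ i) ?coef_trunc ?f0 ?subrr //.
apply: eq_bigr => -[k /=]; rewrite ltnS => hk _.
rewrite coef_trunc ?(leq_trans hk hi) //; congr (_ * _).
by apply: (fps_expE (N := N)) => // j hj; rewrite coef_trunc.
Qed.

Lemma fps_powrD f alpha beta : f 0%N = 1 ->
  fps_powr f (alpha + beta) =1 fps_mul (fps_powr f alpha) (fps_powr f beta).
Proof.
move=> f0 n; pose G := fps_trunc n (fun i => f i - fps_one i).
have G0 : G`_0 = 0 by rewrite coef_trunc ?f0 ?subrr.
rewrite (fps_mulE (N := n)
  (p := fps_trunc n (binr alpha) \Po G) (r := fps_trunc n (binr beta) \Po G)) //;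
  try by move=> i hi; apply: fps_powrE.
rewrite -comp_polyM (fps_powrE (N := n)) // !(@coef_comp _ _ n) //.
apply: eq_bigr => -[k /=]; rewrite ltnS => hk _; congr (_ * _).
rewrite coef_trunc // binrD coefM; apply: eq_bigr => -[j /=]; rewrite ltnS => hj _.
by rewrite !coef_trunc // (leq_trans _ hk) ?leq_subr.
Qed.

Lemma binr0 x : binr x 0 = 1.
Proof. by rewrite /binr /ffactr big_ord0 fact0 mul1r invr1. Qed.

Lemma fps_powr0 f : fps_powr f 0 =1 fps_one.
Proof.
move=> n; rewrite /fps_powr big_ord_recl big1 => [|i _].
  by rewrite binr0 mul1r addr0.
by rewrite /binr /ffactr /= big_ord_recl subr0 !mul0r.
Qed.

Lemma fps_powr1 f : f 0%N = 1 -> fps_powr f 1 =1 f.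
Proof.
move=> f0 n; pose G := fps_trunc n (fun i => f i - fps_one i).
have G0 : G`_0 = 0 by rewrite coef_trunc ?f0 ?subrr.
have -> : f n = ((1 + 'X) \Po G)`_n.
  rewrite comp_polyD comp_polyX -[1]/(1%:P) comp_polyC coefD coef_trunc // coefC.
  by rewrite /fps_one; case: (n == _); rewrite addrC ?subrK ?subr0 ?addr0.
rewrite (fps_powrE (N := n)) // !(@coef_comp _ _ n) //.
apply: eq_bigr => -[k /=]; rewrite ltnS => hk _; congr (_ * _).
rewrite coef_trunc // coefD coef1 coefX.
case: k hk => [|[|k]] _; first by rewrite binr0 addr0.
  by rewrite /binr /ffactr big_ord_recl big_ord0 subr0 mulr1.
by rewrite /binr /ffactr !big_ord_recl /= subrr mul0r mulr0 mul0r addr0.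
Qed.

Lemma eq_fps_mul f f' g g' : f =1 f' -> g =1 g' -> fps_mul f g =1 fps_mul f' g'.
Proof. by move=> hf hg n; apply: eq_bigr => i _; rewrite hf hg. Qed.

Lemma eq_fps_exp f f' k : f =1 f' -> fps_exp f k =1 fps_exp f' k.
Proof. by move=> hf; elim: k => //= k IH; apply: eq_fps_mul. Qed.

Lemma fps_powrMn f alpha k : f 0%N = 1 ->
  fps_powr f (alpha *+ k) =1 fps_exp (fps_powr f alpha) k.
Proof.
move=> f0; elim: k => [|k IH] n; first by rewrite mulr0n fps_powr0.
by rewrite mulrS fps_powrD //=; apply: eq_fps_mul.
Qed.

Lemma fps_powr_coef0 f alpha : fps_powr f alpha 0 = 1.
Proof.
rewrite /fps_powr big_ord_recl big_ord0 addr0.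
by rewrite binr0 mul1r.
Qed.

Lemma mulrn_denq (alpha : rat) : alpha *+ `|denq alpha| = (numq alpha)%:~R.
Proof. by rewrite pmulrn absz_denq -mulrzr numqE. Qed.

Lemma fps_powr_root_ge0 f alpha : f 0%N = 1 -> 0 <= alpha ->
  fps_exp (fps_powr f alpha) `|denq alpha| =1 fps_exp f `|numq alpha|.
Proof.
move=> f0 a0 n; rewrite -fps_powrMn // mulrn_denq.
have -> : (numq alpha)%:~R = 1 *+ `|numq alpha| :> rat.
  by rewrite -[RHS]/(`|numq alpha|%:R) natr_absz ger0_norm ?numq_ge0.
by rewrite fps_powrMn //; apply: eq_fps_exp; apply: fps_powr1.
Qed.

Lemma fps_powr_root_le0 f alpha : f 0%N = 1 -> alpha <= 0 ->
  fps_mul (fps_exp (fps_powr f alpha) `|denq alpha|) (fps_exp f `|numq alpha|)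
  =1 fps_one.
Proof.
move=> f0 a0 n.
have -> : fps_one n = fps_powr f (alpha *+ `|denq alpha| + 1 *+ `|numq alpha|) n.
  rewrite mulrn_denq -[1 *+ _]/(`|numq alpha|%:R) natr_absz ler0_norm ?numq_le0 //.
  by rewrite rmorphN /= subrr fps_powr0.
rewrite fps_powrD //; apply: eq_fps_mul => i; rewrite fps_powrMn //.
by apply: eq_fps_exp => j; rewrite fps_powr1.
Qed.

Lemma qpoch0 : qpoch 0 = 1.
Proof. by rewrite /qpoch big_nil coef1. Qed.

Lemma qpochE N n : (n <= N)%N ->
  qpoch n = (\prod_(1 <= k < N.+1) (1 - 'X^k) : {poly rat})`_n.
Proof.
elim: N => [|N IH]; first by rewrite leqn0 => /eqP->.
rewrite leq_eqVlt => /predU1P[->//|]; rewrite ltnS => hn.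
by rewrite big_nat_recr //= mulrBr mulr1 coefB coefMXn ltnS hn subr0 IH.
Qed.

(* Main.v *)
Require Import Defs.
From HB Require Import structures.
From mathcomp Require Import all_boot all_order all_algebra all_field.
From mathcomp Require Import constructive_ereal boolp.
From Stdlib Require BinInt.
From mathcomp Require Import ssrZ zify ring lra.

Set Implicit Arguments.
Unset Strict Implicit.
Unset Printing Implicit Defensive.

Import Order.TTheory GRing.Theory Num.Theory.
Local Open Scope ring_scope.

(** Write [alpha = d + beta] and let [m] be the order of [beta] at [l].  Since
    [D (f^beta) * f = beta * f^beta * D f], the product [j * p_beta(j)] is
    divisible by [l^m] ([powq_bound]): the coefficient [p_beta(j)] loses only
    the powers of [l] contained in [j].  In
    [p_alpha(k) = sum_j p_d(k - j) p_beta(j)] this loss is made up for by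
    [p_d(k - j)].  Indeed [l] divides [N = 24 k + d] exactly once, so for
    [l | j] it divides [24 (k - j) + d], exactly once if [l^2 | j]; hence the
    theorem follows as soon as [l | 24 i + d] implies [l | p_d(i)], and even
    [p_d(i) = 0] when [l^2] does not divide [24 i + d] ([inert_eta], used in
    [ldvd_coef]).

    For the six values of [d] the power [eta^d] is a combination of forms with
    complex multiplication by Q(i) or Q(sqrt -3) in which every satisfactory
    prime is inert.  Concretely, some multiple of [eta^d] is a sum of series
    [sum_(x, y) P(x, y) q^(k x^2 + k' y^2)] with [P] of positive degree up to
    characters.  The quadratic form is anisotropic modulo [l], so [l | N] forces
    [l | x] and [l | y], whence [l^2 | N] and [l | P(x, y)].

    All series are power series in the 24th root of the usual variable, so that
    [eta = q prod_n (1 - q^(24 n))] and [D = q d/dq].  The identities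
    [theta_eta * theta_eta3 = 4 eta^4], [theta_eta3^2 = 4 eta^6], [eta8],
    [eta10], [eta14] and [eta26] are differential: they express a combination of
    products of derivatives of two one-variable theta series as a power of
    [eta].  To verify them, the Jacobi theta constants and the needed series are
    written as eta quotients, with the Jacobi triple product and with
    rearrangements of double series along isometries of lattices.  Then all
    their logarithmic derivatives are linear in [T = D theta4 / theta4],
    [X = theta4^4] and [Y = theta2^4], which satisfy Halphen's system
    [D X = 4 T X], [D Y = 4 (T + 6 X + 6 Y) Y],
    [D T = 2 T^2 - 72 Y (X + Y)]; the identities become polynomial identities in
    [T], [X], [Y].  The first two equations come from evaluating
    [D f * g - f * D g] for pairs of theta constants by rotating Z^2 by 45
    degrees ([bracket23], [bracket34]).  The third one is forced by the Landen
    transformation: the defect [w] of the equation satisfies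
    [w(q) = 4 w(q^2)], hence [w = 0]. *)

(** * Formal power series over the rationals *)

(** A record rather than a bare function type, so that the ring structure
    below cannot be confused with the pointwise one. *)
Record fps := Fps { fcoef :> nat -> rat }.

Lemma fpsP (f g : fps) : f =1 g -> f = g.
Proof. by case: f g => f [g] /funext /= ->. Qed.

HB.instance Definition _ := gen_eqMixin fps.
HB.instance Definition _ := gen_choiceMixin fps.

Definition fps0 := Fps (fun=> 0).
Definition fps1 := Fps fps_one.
Definition fps_add (f g : fps) := Fps (fun n => f n + g n).
Definition fps_opp (f : fps) := Fps (fun n => - f n).
Definition fps_times (f g : fps) := Fps (fps_mul f g).

Fact fps_addA : associative fps_add.
Proof. by move=> f g h; apply: fpsP => n /=; rewrite addrA. Qed.
Fact fps_addC : commutative fps_add.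
Proof. by move=> f g; apply: fpsP => n /=; rewrite addrC. Qed.
Fact fps_add0 : left_id fps0 fps_add.
Proof. by move=> f; apply: fpsP => n /=; rewrite add0r. Qed.
Fact fps_addN : left_inverse fps0 fps_opp fps_add.
Proof. by move=> f; apply: fpsP => n /=; rewrite addNr. Qed.

HB.instance Definition _ :=
  GRing.isZmodule.Build fps fps_addA fps_addC fps_add0 fps_addN.

Lemma fps_timesE N (f g : fps) i : (i <= N)%N ->
  fps_times f g i = (fps_trunc N f * fps_trunc N g)`_i.
Proof. by apply: fps_mulE => j hj; rewrite coef_trunc. Qed.

Lemma coef_trunc_times N (f g : fps) i : (i <= N)%N ->
  (fps_trunc N (fps_times f g))`_i = (fps_trunc N f * fps_trunc N g)`_i.
Proof. by move=> hi; rewrite coef_trunc // (fps_timesE f g hi). Qed.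

Fact fps_timesA : associative fps_times.
Proof.
move=> f g h; apply: fpsP => n; rewrite !(@fps_timesE n) //.
rewrite (@eq_coefM n _ (fps_trunc n f) _ (fps_trunc n g * fps_trunc n h)) //; last first.
  by move=> i hi; apply: coef_trunc_times.
rewrite [RHS](@eq_coefM n _ (fps_trunc n f * fps_trunc n g) _ (fps_trunc n h)) ?mulrA //.
by move=> i hi; apply: coef_trunc_times.
Qed.

Fact fps_timesC : commutative fps_times.
Proof. by move=> f g; apply: fpsP => n; rewrite !(@fps_timesE n) // mulrC. Qed.

Fact fps_times1 : left_id fps1 fps_times.
Proof.
move=> f; apply: fpsP => n /=; rewrite /fps_mul big_ord_recl big1 => [|i _].
  by rewrite mul1r subn0 addr0.
by rewrite /fps_one mul0r.
Qed.

Fact fps_timesDl : left_distributive fps_times fps_add.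
Proof.
move=> f g h; apply: fpsP => n /=; rewrite -big_split /=.
by apply: eq_bigr => i _; rewrite mulrDl.
Qed.

Fact fps_oner_neq0 : fps1 != 0.
Proof. by apply/eqP => /(congr1 (fun f : fps => f 0%N)) /eqP; rewrite oner_eq0. Qed.

HB.instance Definition _ := GRing.Zmodule_isComNzRing.Build fps
  fps_timesA fps_timesC fps_times1 fps_timesDl fps_oner_neq0.

Lemma fcoefD (f g : fps) n : (f + g) n = f n + g n. Proof. by []. Qed.
Lemma fcoefN (f : fps) n : (- f) n = - f n. Proof. by []. Qed.
Lemma fcoefB (f g : fps) n : (f - g) n = f n - g n. Proof. by []. Qed.
Lemma fcoef0 n : (0 : fps) n = 0. Proof. by []. Qed.
Lemma fcoef1 n : (1 : fps) n = (n == 0%N)%:R. Proof. by []. Qed.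
Lemma fcoefM (f g : fps) n : (f * g) n = \sum_(i < n.+1) f i * g (n - i)%N.
Proof. by []. Qed.
Lemma fcoefMn (f : fps) k n : (f *+ k) n = f n *+ k.
Proof. by elim: k => // k IH; rewrite !mulrS fcoefD IH. Qed.
Lemma fcoefMz (f : fps) (k : int) n : (f *~ k) n = f n *~ k.
Proof. by case: k => k; rewrite /intmul ?fcoefN fcoefMn. Qed.
Lemma fcoef_sum I (r : seq I) (P : pred I) (F : I -> fps) n :
  (\sum_(i <- r | P i) F i) n = \sum_(i <- r | P i) F i n.
Proof. by apply: (big_morph (fun f : fps => f n)). Qed.
Lemma fcoef_natl k (f : fps) n : (k%:R * f) n = k%:R * f n.
Proof. by rewrite !mulr_natl fcoefMn. Qed.
Lemma fcoefM0 (f g : fps) : (f * g) 0%N = f 0%N * g 0%N.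
Proof. by rewrite fcoefM big_ord1. Qed.
Lemma fcoefX0 (f : fps) k : (f ^+ k) 0%N = f 0%N ^+ k.
Proof. by elim: k => // k IH; rewrite !exprS fcoefM0 IH. Qed.
Lemma fcoefX (f : fps) k n : (f ^+ k) n = fps_exp f k n.
Proof.
by elim: k n => // k IH n; rewrite exprS fcoefM; apply: eq_bigr => i _; rewrite IH.
Qed.

Lemma fps_low (f : fps) : f != 0 -> exists2 m, f m != 0 & forall i, (i < m)%N -> f i = 0.
Proof.
move=> nz; have /existsNP[m /eqP fm] : ~ forall n, f n = 0.
  by move=> h; case/eqP: nz; apply: fpsP.
have ex : exists n, f n != 0 by exists m.
case: (ex_minnP ex) => k fk mink; exists k => // i ik.
by apply/eqP; apply: contraTT ik => fi; rewrite -leqNgt mink.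
Qed.

(** The lowest coefficient of a product is the product of the lowest
    coefficients. *)
Lemma fps_mulf_eq0 (f g : fps) : f * g = 0 -> f != 0 -> g = 0.
Proof.
move=> fg0 nzf; apply/eqP; apply/negPn/negP => nzg.
have [m fm lowf] := fps_low nzf; have [k gk lowg] := fps_low nzg.
have := congr1 (fun h : fps => h (m + k)%N) fg0.
have hm : (m < (m + k).+1)%N by rewrite ltnS leq_addr.
rewrite fcoefM fcoef0 (bigD1 (Ordinal hm)) //= addKn big1 ?addr0.
  by apply/eqP; rewrite mulf_neq0.
move=> i ne; case: (ltngtP i m) => [im|im|im].
- by rewrite lowf ?mul0r.
- by rewrite lowg ?mulr0 // ltn_subLR ?ltn_add2r // -ltnS.
- by case/eqP: ne; apply: val_inj.
Qed.

Lemma fps_mulfI (f : fps) : f != 0 -> injective (fun g => f * g).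
Proof.
move=> nz g h /= /eqP; rewrite -subr_eq0 -mulrBr => /eqP e.
by apply/eqP; rewrite -subr_eq0; apply/eqP; apply: fps_mulf_eq0 e nz.
Qed.

Lemma fps_neq0 (f : fps) n : f n != 0 -> f != 0.
Proof. by apply: contraNneq => ->. Qed.

Lemma fps_mulf_neq0 (f g : fps) : f != 0 -> g != 0 -> f * g != 0.
Proof. by move=> nf; apply: contraNneq => h; rewrite (fps_mulf_eq0 h). Qed.

Lemma fps_expf_neq0 (f : fps) n : f != 0 -> f ^+ n != 0.
Proof.
move=> nf; elim: n => [|n IH]; first exact: oner_neq0.
by rewrite exprS fps_mulf_neq0.
Qed.

Lemma fps_natf_neq0 n : (n.+1%:R : fps) != 0.
Proof.
by apply: (@fps_neq0 _ 0); rewrite fcoefMn fcoef1 eqxx pnatr_eq0.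
Qed.

(** The geometric series in [1 - f]; as [(1 - f)^k] starts in degree at least
    [k] when [f] has constant term 1, the terms with [k > n] do not contribute
    to the coefficient of degree [n]. *)
Definition fps_inv (f : fps) := Fps (fun n => \sum_(k < n.+1) ((1 - f) ^+ k) n).

Lemma fps_mulfV (f : fps) : f 0%N = 1 -> f * fps_inv f = 1.
Proof.
move=> f0; rewrite /fps_inv; have [h hE] : exists h, h = 1 - f by exists (1 - f).
rewrite -hE.
have h0 : h 0%N = 0 by rewrite hE fcoefB f0 subrr.
have low k i : (i < k)%N -> (h ^+ k) i = 0.
  elim: k i => // k IH i; rewrite ltnS => ik;
    rewrite exprS fcoefM big1 // => -[j hj] _ /=.
  case: j hj => [|j] hj; first by rewrite h0 mul0r.
  by rewrite IH ?mulr0 //; lia.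
apply: fpsP => n.
transitivity (((1 - h) * \sum_(k < n.+1) h ^+ k) n).
  have -> : 1 - h = f by rewrite hE opprB addrCA subrr addr0.
  rewrite !fcoefM; apply: eq_bigr => i _; congr (_ * _).
  rewrite fcoef_sum /=; set m := (n - i)%N.
  have mn : (m.+1 <= n.+1)%N by rewrite ltnS leq_subr.
  rewrite -!(big_mkord xpredT (fun k => (h ^+ k) m)) [RHS](big_cat_nat (leq0n _) mn) /=.
  rewrite [X in _ = _ + X]big_nat_cond [X in _ = _ + X]big1 ?addr0 //.
  by move=> k /andP[/andP[mk _] _]; apply: low.
have -> : (1 - h) * \sum_(k < n.+1) h ^+ k = 1 - h ^+ n.+1.
  by rewrite -[X in _ = X - _](expr1n _ n.+1) subrXX; congr (_ * _);
     apply: eq_bigr => i _; rewrite expr1n mul1r.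
by rewrite fcoefB low ?subr0.
Qed.

Definition fps_der (f : fps) := Fps (fun n => n%:R * f n).
Local Notation D := fps_der.

Lemma derD f g : D (f + g) = D f + D g.
Proof. by apply: fpsP => n /=; rewrite mulrDr. Qed.
Lemma derN f : D (- f) = - D f.
Proof. by apply: fpsP => n /=; rewrite mulrN. Qed.
Lemma derB f g : D (f - g) = D f - D g. Proof. by rewrite derD derN. Qed.
Lemma derM f g : D (f * g) = D f * g + f * D g.
Proof.
apply: fpsP => n; rewrite fcoefD !fcoefM /= /fps_mul mulr_sumr -big_split /=.
apply: eq_bigr => -[i /=]; rewrite ltnS => hi _.
by rewrite -{1}(subnKC hi) natrD; ring.
Qed.
Lemma der_nat k : D k%:R = 0.
Proof. by apply: fpsP => -[|n] /=; rewrite ?mul0r // fcoefMn fcoef1 mul0rn mulr0. Qed.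
Lemma der0 : D 0 = 0. Proof. exact: (der_nat 0). Qed.
Lemma der1 : D 1 = 0. Proof. exact: (der_nat 1). Qed.
Lemma der_natM k f : D (k%:R * f) = k%:R * D f.
Proof. by rewrite derM der_nat mul0r add0r. Qed.
Lemma derX f n : D (f ^+ n) = n%:R * f ^+ n.-1 * D f.
Proof.
elim: n => [|[|n] IH]; first by rewrite expr0 der1 !mul0r.
  by rewrite /= expr1 expr0 !mul1r.
by rewrite exprS derM IH /= exprS -[n.+2]addn1 natrD; ring.
Qed.
Lemma der_int (k : int) : D k%:~R = 0.
Proof. by case: k => k; rewrite ?NegzE ?rmorphN /= ?derN der_nat ?oppr0. Qed.
Lemma der_sum I (r : seq I) (F : I -> fps) : D (\sum_(i <- r) F i)
  = \sum_(i <- r) D (F i).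
Proof. exact: (big_morph D derD der0). Qed.

(** A first order linear equation determines its solution from the constant
    term; this turns equality of logarithmic derivatives into equality. *)
Lemma der_uniq (T f g : fps) :
  D f = T * f -> D g = T * g -> f 0%N = 1 -> g 0%N = 1 -> f = g.
Proof.
move=> hf hg f0 g0.
have T0 : T 0%N = 0.
  by have := congr1 (fun h : fps => h 0%N) hf; rewrite fcoefM0 f0 mulr1 /= mul0r.
have hw : D (f - g) = T * (f - g) by rewrite derB hf hg mulrBr.
have w0 : (f - g) 0%N = 0 by rewrite fcoefB f0 g0 subrr.
apply/eqP; rewrite -subr_eq0; apply/eqP; move: (f - g) hw w0 => w hw w0.
apply: fpsP => n; elim/ltn_ind: n => -[|n] IH //.
have := congr1 (fun h : fps => h n.+1) hw; rewrite fcoefM big_ord_recl T0 mul0r add0r.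
rewrite big1 => [/eqP|i _]; last by rewrite IH ?mulr0 // /bump /= ltnS subSS leq_subr.
by rewrite /= mulf_eq0 pnatr_eq0 => /eqP.
Qed.

Definition fps_V (k : nat) (f : fps) := Fps (fun n =>
  if (k %| n)%N then f (n %/ k)%N else 0).
Local Notation V := fps_V.

Lemma VD k f g : V k (f + g) = V k f + V k g.
Proof. by apply: fpsP => n /=; case: ifP; rewrite ?addr0. Qed.
Lemma VM k f g : (0 < k)%N -> V k (f * g) = V k f * V k g.
Proof.
move=> k0; apply: fpsP => n.
have trV (h : fps) i : (i <= n)%N -> (fps_trunc n h \Po 'X^k)`_i = V k h i.
  move=> hi; rewrite coef_comp_poly_Xn //=; case: ifP => // _.
  by rewrite coef_trunc // (leq_trans (leq_div _ _)).
rewrite [RHS](@fps_mulE n _ _ n (fps_trunc n f \Po 'X^k) (fps_trunc n g \Po 'X^k)) //;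
  try by move=> i hi; rewrite trV.
rewrite -comp_polyM coef_comp_poly_Xn //=; case: ifP => // _.
by rewrite [LHS](@fps_timesE n) // leq_div.
Qed.
Lemma V1 k : V k 1 = 1.
Proof.
apply: fpsP => -[|n] /=; first by rewrite dvdn0 div0n.
case: ifP => // /dvdnP[m e]; rewrite /fps_one e.
case: k m e => [|k] [|m] // e; first by rewrite muln0 in e.
by rewrite mulnK.
Qed.
Lemma VX k f n : (0 < k)%N -> V k (f ^+ n) = V k f ^+ n.
Proof. by move=> k0; elim: n => [|n IH]; rewrite ?V1 // !exprS VM // IH. Qed.
Lemma VN k f : V k (- f) = - V k f.
Proof. by apply: fpsP => n /=; case: ifP; rewrite ?oppr0. Qed.
Lemma VB k f g : V k (f - g) = V k f - V k g. Proof. by rewrite VD VN. Qed.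
Lemma V0 k : V k 0 = 0. Proof. by apply: fpsP => n /=; case: ifP. Qed.
Lemma V_nat k n : V k n%:R = n%:R.
Proof. by elim: n => [|n IH]; rewrite ?V0 // -addn1 natrD VD IH V1. Qed.
Lemma V_natM k n f : (0 < k)%N -> V k (n%:R * f) = n%:R * V k f.
Proof. by move=> k0; rewrite VM // V_nat. Qed.
Lemma V_V j k f : (0 < j)%N -> (0 < k)%N -> V j (V k f) = V (j * k) f.
Proof.
move=> j0 k0; apply: fpsP => n /=; case: (boolP (j %| n)%N) => [jn|jn].
  have [m ->] := dvdnP jn; rewrite mulnK // [(j * k)%N]mulnC dvdn_pmul2r //.
  by case: ifP => // _; rewrite divnMr.
by case: ifP => // h; case/negP: jn; apply: dvdn_trans h; apply: dvdn_mulr.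
Qed.
Lemma der_V k f : D (V k f) = k%:R * V k (D f).
Proof.
apply: fpsP => n; rewrite fcoef_natl /=; case: ifP => [/dvdnP[m ->]|_];
  last by rewrite !mulr0.
case: k => [|k]; first by rewrite muln0 !mul0r.
by rewrite mulnK // mulrA -natrM mulnC.
Qed.
Lemma V_neq0 k f : (0 < k)%N -> f != 0 -> V k f != 0.
Proof.
move=> k0 /fps_low[m fm _]; apply: (@fps_neq0 _ (m * k)%N).
by rewrite /= dvdn_mull // mulnK.
Qed.

Definition fps_mono (k : nat) := Fps (fun n => (n == k)%:R).
Lemma fcoef_monoM k f n : (fps_mono k * f) n = if (k <= n)%N then f (n - k)%N else 0.
Proof.
rewrite fcoefM; case: leqP => kn.
  have hk : (k < n.+1)%N by [].
  rewrite (bigD1 (Ordinal hk)) //= eqxx mul1r big1 ?addr0 // => i ne.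
  by rewrite -val_eqE /= in ne; rewrite (negbTE ne) mul0r.
rewrite big1 // => i _ /=; case: eqP => [e|]; last by rewrite mul0r.
by have := ltn_ord i; rewrite e ltnS leqNgt kn.
Qed.
Lemma monoD j k : fps_mono (j + k) = fps_mono j * fps_mono k.
Proof.
apply: fpsP => n; rewrite fcoef_monoM /=; case: leqP => jn.
  by congr ((_)%:R); lia.
by rewrite (ltn_eqF (leq_trans jn (leq_addr _ _))).
Qed.
Lemma mono0 : fps_mono 0 = 1. Proof. by []. Qed.
Lemma monoX k n : fps_mono k ^+ n = fps_mono (k * n).
Proof. by elim: n => [|n IH]; rewrite ?muln0 // mulnS monoD -IH exprS. Qed.
Lemma V_mono k j : (0 < k)%N -> V k (fps_mono j) = fps_mono (k * j).
Proof.
move=> k0; apply: fpsP => n /=; case: ifP => [/dvdnP[m ->]|h].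
  by rewrite mulnK // [(m * k)%N]mulnC eqn_pmul2l.
by case: eqP => // e; rewrite e dvdn_mulr in h.
Qed.
Lemma mono_neq0 k : fps_mono k != 0.
Proof. by apply: (@fps_neq0 _ k); rewrite /= eqxx. Qed.

(** * Theta series of one and two variables *)

(** Two sums agree when the supports of their terms correspond under mutually
    inverse maps; terms outside the supports are unconstrained, which is what
    makes rearrangements of lattice sums cut off by a box painless. *)
Lemma sum_bij (R : nmodType) (I J : eqType) (r : seq I) (s : seq J)
    (F : I -> R) (G : J -> R) (h : I -> J) (h' : J -> I) :
  uniq r -> uniq s ->
  (forall i, i \in r -> F i != 0 -> [/\ h i \in s, G (h i) = F i & h' (h i) = i]) ->
  (forall j, j \in s -> G j != 0 -> [/\ h' j \in r, F (h' j) = G j & h (h' j) = j]) ->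
  \sum_(i <- r) F i = \sum_(j <- s) G j.
Proof.
move=> ur us hF hG.
have nz (K : eqType) (t : seq K) (H : K -> R) :
    \sum_(i <- t) H i = \sum_(i <- t | H i != 0) H i.
  rewrite [LHS](bigID (fun i => H i == 0)) /= big1 ?add0r // => i /eqP //.
rewrite (nz _ r) (nz _ s) -[LHS]big_filter -[RHS]big_filter.
have -> : \sum_(i <- [seq i <- r | F i != 0]) F i
        = \sum_(i <- [seq i <- r | F i != 0]) G (h i).
  rewrite big_seq [RHS]big_seq; apply: eq_bigr => i.
  by rewrite mem_filter => /andP[Fi ri]; have [_ ->] := hF i ri Fi.
rewrite -(big_map h xpredT); apply: perm_big; apply: uniq_perm.
- rewrite map_inj_in_uniq ?filter_uniq // => i j; rewrite !mem_filter.
  move=> /andP[Fi ri] /andP[Fj rj] e.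
  by have [_ _ <-] := hF i ri Fi; rewrite e; have [_ _ ->] := hF j rj Fj.
- exact: filter_uniq.
move=> j; rewrite mem_filter; apply/mapP/andP => [[i]|[Gj sj]].
  by rewrite mem_filter => /andP[Fi ri] ->; have [? -> _] := hF i ri Fi.
have [rj FG e] := hG j sj Gj.
by exists (h' j); rewrite ?mem_filter ?FG ?Gj.
Qed.

Definition zbox (n : nat) : seq int := [seq i%:Z - n%:Z | i <- iota 0 n.*2.+1].

Arguments zbox : simpl never.

Lemma mem_zbox n x : (x \in zbox n) = (`|x| <= n)%N.
Proof.
apply/mapP/idP => [[i]|h].
  by rewrite mem_iota => h ->; lia.
exists (absz (x + n%:Z)); last by lia.
by rewrite mem_iota; lia.
Qed.

Lemma zbox_uniq n : uniq (zbox n).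
Proof. by rewrite map_inj_uniq ?iota_uniq // => i j; lia. Qed.

(** The series [sum_(x in Z) c(x) q^(k x^2)]. *)
Definition th (k : nat) (c : int -> int) : fps := Fps (fun n =>
  (\sum_(x <- zbox n) if (k * `|x| ^ 2 == n)%N then c x else 0)%:~R).

(** The series [sum_((x, y) in Z^2) c(x, y) q^(k x^2 + k' y^2)]. *)
Definition th2 (k k' : nat) (c : int * int -> int) : fps := Fps (fun n =>
  (\sum_(p <- [seq (x, y) | x <- zbox n, y <- zbox n])
    if (k * `|p.1| ^ 2 + k' * `|p.2| ^ 2 == n)%N then c p else 0)%:~R).

Lemma mem_zbox2 n p :
  (p \in [seq (x, y) | x <- zbox n, y <- zbox n]) = (`|p.1| <= n)%N && (`|p.2| <= n)%N.
Proof.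
rewrite -!mem_zbox; apply/idP/andP => [/allpairsP[q [? ? ->]] //|[? ?]].
by apply/allpairsP; exists p; split=> //; apply: surjective_pairing.
Qed.

Lemma zbox2_uniq n : uniq [seq (x, y) | x <- zbox n, y <- zbox n].
Proof. by apply: allpairs_uniq; rewrite ?zbox_uniq // => -[a b] [c d]. Qed.

Lemma sqr_absz (x : int) : ((`|x| ^ 2)%N)%:Z = x ^+ 2.
Proof. by rewrite -mulnn PoszM abszE -normrM ger0_norm ?sqr_ge0 -?expr2 ?sqr_ge0. Qed.

Lemma leq_of_sqr k x n : (0 < k)%N -> (k * x ^ 2 <= n)%N -> (x <= n)%N.
Proof. by move=> k0 h; nia. Qed.

(** A bijection between the supports that transports one quadratic form to the
    other rearranges the double series; the maps need not preserve the whole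
    of Z^2. *)
Lemma th2_bij k k' m m' (h h' : int * int -> int * int) c c' :
  (0 < k)%N -> (0 < k')%N -> (0 < m)%N -> (0 < m')%N ->
  (forall p, c p != 0 -> [/\ c' (h p) = c p, h' (h p) = p &
     m%:Z * (h p).1 ^+ 2 + m'%:Z * (h p).2 ^+ 2 = k%:Z * p.1 ^+ 2 + k'%:Z * p.2 ^+ 2]) ->
  (forall p, c' p != 0 -> c (h' p) = c' p /\ h (h' p) = p) ->
  th2 k k' c = th2 m m' c'.
Proof.
move=> k0 k'0 m0 m'0 hc hc'; apply: fpsP => n /=; congr (_%:~R).
have box a b (p : int * int) : (0 < a)%N -> (0 < b)%N ->
    (a * `|p.1| ^ 2 + b * `|p.2| ^ 2 == n)%N ->
    p \in [seq (x, y) | x <- zbox n, y <- zbox n].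
  move=> a0 b0 /eqP e.
  rewrite mem_zbox2; apply/andP; split.
    by apply: (leq_of_sqr a0); rewrite -e leq_addr.
  by apply: (leq_of_sqr b0); rewrite -e leq_addl.
have qE a b (p : int * int) : (a * `|p.1| ^ 2 + b * `|p.2| ^ 2)%N%:Z
    = a%:Z * p.1 ^+ 2 + b%:Z * p.2 ^+ 2.
  by rewrite PoszD; congr (_ + _); rewrite PoszM sqr_absz.
have form p : c p != 0 -> (m * `|(h p).1| ^ 2 + m' * `|(h p).2| ^ 2)%N
    = (k * `|p.1| ^ 2 + k' * `|p.2| ^ 2)%N.
  by move=> cp; have [_ _ e] := hc p cp; apply/eqP; rewrite -eqz_nat !qE e.
apply: (sum_bij (h := h) (h' := h')) => //; try exact: zbox2_uniq.
- move=> p _; case: ifP => [e cp|_]; last by rewrite eqxx.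
  have [e1 e2 _] := hc p cp; split=> //; last by rewrite form // e.
  by apply: (box m m'); rewrite // form.
move=> p _; case: ifP => [e cp|_]; last by rewrite eqxx.
have [e1 e2] := hc' p cp.
have cp' : c (h' p) != 0 by rewrite e1.
have e' := form _ cp'; rewrite e2 in e'.
by split=> //; [apply: (box k k') => // |]; rewrite -e' e.
Qed.

Lemma fcoef_monoMz k (c : int) n : (fps_mono k *~ c) n
  = (if (k == n)%N then c else 0)%:~R.
Proof. by rewrite fcoefMz /= eq_sym; case: eqP => _; rewrite ?mul0rz. Qed.

Lemma th_box k c N n : (0 < k)%N -> (n <= N)%N ->
  th k c n = (\sum_(x <- zbox N) fps_mono (k * `|x| ^ 2) *~ c x) n.
Proof.
move=> k0 nN; rewrite fcoef_sum /= rmorph_sum /=.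
apply: (sum_bij (h := id) (h' := id)); try exact: zbox_uniq.
- move=> x; rewrite mem_zbox fcoef_monoMz => hx nz; split=> //.
  by rewrite mem_zbox (leq_trans hx).
move=> x _; rewrite fcoef_monoMz; case: ifP => [/eqP e _|_]; last by rewrite eqxx.
by split=> //; rewrite mem_zbox (leq_of_sqr k0) // e.
Qed.

Lemma th2E k k' c n : th2 k k' c n = (\sum_(x <- zbox n) \sum_(y <- zbox n)
  if (k * `|x| ^ 2 + k' * `|y| ^ 2 == n)%N then c (x, y) else 0)%:~R.
Proof. by congr (_%:~R); apply: big_allpairs. Qed.

Lemma thM k k' c c' : (0 < k)%N -> (0 < k')%N ->
  th k c * th k' c' = th2 k k' (fun p => c p.1 * c' p.2).
Proof.
move=> k0 k'0; apply: fpsP => n.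
transitivity (((\sum_(x <- zbox n) fps_mono (k * `|x| ^ 2) *~ c x)
   * (\sum_(x <- zbox n) fps_mono (k' * `|x| ^ 2) *~ c' x)) n).
  rewrite !fcoefM; apply: eq_bigr => i _.
  by rewrite !(@th_box _ _ n) ?leq_subr // -ltnS.
rewrite th2E big_distrlr fcoef_sum rmorph_sum.
apply: eq_bigr => x _; rewrite fcoef_sum rmorph_sum; apply: eq_bigr => y _.
rewrite -[LHS]/((fps_mono _ *~ c x * (fps_mono _ *~ c' y)) n).
by rewrite mulrzAl mulrzAr -mulrzA -monoD fcoef_monoMz [c' y * _]mulrC.
Qed.

Lemma der_th k c : D (th k c) = th k (fun x => k%:Z * x ^+ 2 * c x).
Proof.
apply: fpsP => n /=; rewrite -[n%:R]/(n%:Z%:~R) -intrM mulr_sumr; congr (_%:~R).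
by apply: eq_bigr => x _; case: eqP => [<-|]; rewrite ?mulr0 // -sqr_absz PoszM.
Qed.

Lemma eq_th k c c' : c =1 c' -> th k c = th k c'.
Proof.
by move=> e; apply: fpsP => n /=; congr (_%:~R); apply: eq_bigr => x _; rewrite e.
Qed.

Lemma V_th m k c : (0 < m)%N -> (0 < k)%N -> V m (th k c) = th (m * k) c.
Proof.
move=> m0 k0; apply: fpsP => n /=; case: ifP => [/dvdnP[j ->]|ndv]; last first.
  rewrite big1 // => x _; case: eqP => // e.
  by rewrite -e -mulnA dvdn_mulr in ndv.
rewrite mulnK //; congr (_%:~R).
apply: (sum_bij (h := id) (h' := id)); try exact: zbox_uniq.
- move=> x; rewrite !mem_zbox => hx nz; split=> //;
  first by rewrite (leq_trans hx) // leq_pmulr.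
  by rewrite [(j * m)%N]mulnC -mulnA eqn_pmul2l.
move=> x _; rewrite [(j * m)%N]mulnC -mulnA eqn_pmul2l //.
by case: ifP => [/eqP e _|_]; rewrite ?eqxx // mem_zbox (leq_of_sqr k0) // e.
Qed.

Lemma th2D k k' c c' : th2 k k' c + th2 k k' c' = th2 k k' (fun p => c p + c' p).
Proof.
apply: fpsP => n; rewrite fcoefD /= -rmorphD -big_split /=; congr (_%:~R).
by apply: eq_bigr => p _; case: ifP.
Qed.
Lemma th2N k k' c : - th2 k k' c = th2 k k' (fun p => - c p).
Proof.
apply: fpsP => n; rewrite fcoefN /= -rmorphN -sumrN; congr (_%:~R).
by apply: eq_bigr => p _; case: ifP; rewrite ?oppr0.
Qed.
Lemma th2B k k' c c' : th2 k k' c - th2 k k' c' = th2 k k' (fun p => c p - c' p).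
Proof. by rewrite th2N th2D. Qed.
Lemma th2Mn k k' c j : j%:R * th2 k k' c = th2 k k' (fun p => j%:Z * c p).
Proof.
apply: fpsP => n; rewrite fcoef_natl /= -[j%:R]/(j%:Z%:~R) -rmorphM mulr_sumr.
by congr (_%:~R); apply: eq_bigr => p _; case: ifP; rewrite ?mulr0.
Qed.
Lemma eq_th2 k k' c c' : c =1 c' -> th2 k k' c = th2 k k' c'.
Proof.
by move=> e; apply: fpsP => n /=; congr (_%:~R); apply: eq_bigr => x _; rewrite e.
Qed.

(** An involutive isometry that changes the sign of the coefficients makes the
    series equal to its opposite. *)
Lemma th2_odd k k' (s : int * int -> int * int) c : (0 < k)%N -> (0 < k')%N ->
  (forall p, s (s p) = p) ->
  (forall p, k%:Z * (s p).1 ^+ 2 + k'%:Z * (s p).2 ^+ 2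
    = k%:Z * p.1 ^+ 2 + k'%:Z * p.2 ^+ 2) ->
  (forall p, c (s p) = - c p) -> th2 k k' c = 0.
Proof.
move=> k0 k'0 ss sq cs.
have e : th2 k k' c = - th2 k k' c.
  rewrite th2N; apply: (th2_bij (h := s) (h' := s)) => // p _; split=> //.
    by rewrite cs opprK.
have /eqP := e; rewrite -subr_eq0 opprK -mulr2n -mulr_natl => /eqP.
by move=> h; apply: (fps_mulf_eq0 h); apply: fps_natf_neq0.
Qed.

(** * Identities between double theta series *)

Definition chi4 (x : int) : int :=
  if (x %% 4 == 1)%Z then 1 else if (x %% 4 == 3)%Z then -1 else 0.
Definition chi3 (x : int) : int :=
  if (x %% 3 == 1)%Z then 1 else if (x %% 3 == 2)%Z then -1 else 0.
Definition oddz (x : int) : int := if (x %% 2 == 1)%Z then 1 else 0.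
Definition sgnz (x : int) : int := if (x %% 2 == 1)%Z then -1 else 1.

(** The three Jacobi theta constants, with [q^24] for the classical nome. *)
Definition theta2 := th 6 oddz.
Definition theta3 := th 24 (fun=> 1).
Definition theta4 := th 24 sgnz.
(** Twice the eta function, see [theta_etaE]; [theta_eta3] is twice its
    cube. *)
Definition theta_eta := th 1 (fun x => chi4 x * chi3 x).
Definition theta_eta3 := th 3 (fun x => chi4 x * x).
(** The series attached to the odd character modulo 3, an eta quotient by
    [theta_uE]; [theta_us] is its twist by the parity of the index and
    [theta_v], in another scale, its part with odd index. *)
Definition theta_u := th 8 (fun x => chi3 x * x).
Definition theta_us := th 8 (fun x => sgnz x * chi3 x * x).
Definition theta_v := th 1 (fun x => oddz x * chi3 x * x).

Definition cong4 (s t : int) : bool := (s %% 2 == 1)%Z && ((s - t) %% 4 == 0)%Z.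

Lemma chi4_pair s t :
  chi4 s * chi4 t + oddz s * oddz t = if cong4 s t then 2 else 0.
Proof. by rewrite /chi4 /oddz /cong4; do !case: ifP => ? /=; lia. Qed.

Lemma chi4N x : chi4 (- x) = - chi4 x.
Proof. by rewrite /chi4; do !case: ifP; lia. Qed.
Lemma chi3N x : chi3 (- x) = - chi3 x.
Proof. by rewrite /chi3; do !case: ifP; lia. Qed.
Lemma oddzN x : oddz (- x) = oddz x.
Proof. by rewrite /oddz; do !case: ifP; lia. Qed.
Lemma sgnzN x : sgnz (- x) = sgnz x.
Proof. by rewrite /sgnz; do !case: ifP; lia. Qed.

(** The substitution [s = y + 2 x], [t = y - 2 x] turns [y^2 - 4 x^2] into
    [s t] and identifies the left-hand lattice with the odd pairs that are
    congruent modulo 4. The indicator of this congruence is half the sum of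
    two products of characters: the trivial ones contribute nothing by
    oddness, the other two give the square of [theta_eta3]. *)
Lemma bracket23 : D theta2 * theta3 - theta2 * D theta3 = 3%:R * theta_eta3 ^+ 2.
Proof.
rewrite /theta2 /theta3 /theta_eta3 !der_th expr2 !thM // th2B th2Mn.
have z : th2 3 3 (fun p => 3%:Z * (oddz p.1 * oddz p.2 * p.1 * p.2)) = 0.
  apply: (@th2_odd 3 3 (fun p => (- p.1, p.2))) => // -[x y] /=;
    rewrite ?opprK ?sqrrN ?oddzN //.
  by ring.
rewrite -[RHS]addr0 -z th2D.
apply: (@th2_bij _ _ _ _ (fun p => (p.1 + 2 * p.2, p.1 - 2 * p.2))
  (fun p => (((p.1 + p.2) %/ 2)%Z, ((p.1 - p.2) %/ 4)%Z))) => // -[x y] /=.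
  move=> nz; have ox : (x %% 2 == 1)%Z by move: nz; rewrite /oddz; case: ifP => //;
    rewrite !mul0r !mulr0 !mul0r subrr.
  split.
  - transitivity (3 * (x + 2 * y) * (x - 2 * y)
       * (chi4 (x + 2 * y) * chi4 (x - 2 * y) + oddz (x + 2 * y) * oddz (x - 2 * y))).
      by ring.
    rewrite chi4_pair /oddz ox ifT; last by rewrite /cong4; lia.
    by ring.
  - by congr (_, _); lia.
  - by ring.
move=> nz; have cg : cong4 x y.
  apply: contraNT nz => /negbTE ncg; have := chi4_pair x y; rewrite ncg => e.
  apply/eqP; transitivity (3 * x * y * (chi4 x * chi4 y + oddz x * oddz y));
    first by ring.
  by rewrite e mulr0.
have [u ->] : exists u, x = y + 4 * u.
  by exists ((x - y) %/ 4)%Z; move: cg; rewrite /cong4; lia.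
have -> : ((y + 4 * u + y) %/ 2)%Z = y + 2 * u by lia.
have -> : ((y + 4 * u - y) %/ 4)%Z = u by lia.
have oy : (y %% 2 == 1)%Z by move: cg; rewrite /cong4; lia.
split; last by congr (_, _); ring.
transitivity (3 * (y + 4 * u) * y
   * (chi4 (y + 4 * u) * chi4 y + oddz (y + 4 * u) * oddz y)); last by ring.
rewrite chi4_pair /oddz ifT ?[in RHS]ifT; last 2 first.
- by rewrite /cong4; lia.
- by lia.
by ring.
Qed.

Lemma th2_symm k k' (s : int * int -> int * int) c : (0 < k)%N -> (0 < k')%N ->
  (forall p, s (s p) = p) ->
  (forall p, k%:Z * (s p).1 ^+ 2 + k'%:Z * (s p).2 ^+ 2
    = k%:Z * p.1 ^+ 2 + k'%:Z * p.2 ^+ 2) ->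
  th2 k k' (fun p => c (s p)) = th2 k k' c.
Proof.
by move=> k0 k'0 ss sq; apply: (th2_bij (h := s) (h' := s)) => // p _; rewrite ss.
Qed.

Lemma chi4_rot x y :
  chi4 (x + y) * chi4 (x - y) = if ((x + y) %% 2 == 1)%Z then sgnz y else 0.
Proof. by rewrite /chi4 /sgnz; do !case: ifP => ? /=; lia. Qed.

(** Rotation by 45 degrees: with [s = x + y], [t = x - y], the term
    [x^2 - y^2] becomes [s t]. The pairs with [x + y] even cancel under the
    exchange of [x] and [y]. *)
Lemma bracket34 : D theta3 * theta4 - theta3 * D theta4 = 24%:R * V 4 theta_eta3 ^+ 2.
Proof.
rewrite /theta3 /theta4 /theta_eta3 V_th // !der_th expr2 !thM // th2B th2Mn.
pose E p := if ((p.1 + p.2) %% 2 == 1)%Z then 0 else 24 * (p.1 ^+ 2 - p.2 ^+ 2)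
  * sgnz p.2.
have z : th2 24 24 E = 0.
  apply: (@th2_odd 24 24 (fun p => (p.2, p.1))) => // -[x y] //=; first by ring.
  rewrite /E /= [y + x]addrC; case: ifP => [|h]; first by rewrite oppr0.
  have -> : sgnz y = sgnz x by rewrite /sgnz; do !case: ifP => ? //=; lia.
  by ring.
rewrite -[LHS]subr0 -z th2B.
apply: (@th2_bij _ _ _ _ (fun p => (p.1 + p.2, p.1 - p.2))
  (fun p => (((p.1 + p.2) %/ 2)%Z, ((p.1 - p.2) %/ 2)%Z))) => // -[x y] /=.
  move=> _; split; [|by congr (_, _); lia|by ring].
  transitivity (24 * (x + y) * (x - y) * (chi4 (x + y) * chi4 (x - y))); first by ring.
  by rewrite chi4_rot /E /=; case: ifP => _; ring.
move=> nz; have ox : (x %% 2 == 1)%Z.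
  by move: nz; rewrite /chi4; do !case: ifP => ? //=;
    (lia || rewrite ?mul0r ?mulr0 ?eqxx //).
have oy : (y %% 2 == 1)%Z.
  by move: nz; rewrite /chi4; do !case: ifP => ? //=;
    (lia || rewrite ?mul0r ?mulr0 ?eqxx //).
have [u ->] : exists u, x = y + 2 * u by exists ((x - y) %/ 2)%Z; lia.
have -> : ((y + 2 * u + y) %/ 2)%Z = y + u by lia.
have -> : ((y + 2 * u - y) %/ 2)%Z = u by lia.
split; last by congr (_, _); ring.
have rot : chi4 (y + 2 * u) * chi4 y = sgnz u.
  have := chi4_rot (y + u) u; rewrite addrK ifT; last by lia.
  by have -> : y + u + u = y + 2 * u by ring.
rewrite /E /= ifT; last by lia.
by rewrite subr0 -rot; ring.
Qed.

(** On pairs with [x + y] even, multiplication by a cube root of unity in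
    Q(sqrt -3) acts as an isometry that preserves the residue of the first
    coordinate modulo 3. The three conjugates of a first coordinate sum to
    zero, so averaging over the rotation kills the series. *)
Lemma theta_u_even_eq0 :
  th2 8 24 (fun p => if ((p.1 + p.2) %% 2 == 1)%Z then 0 else chi3 p.1 * p.1) = 0.
Proof.
pose ev (p : int * int) := ~~ ((p.1 + p.2) %% 2 == 1)%Z.
(* multiplication by [(-1 + sqrt -3) / 2] and its inverse, on [x + y sqrt -3] *)
pose rho (p : int * int) := (((- p.1 - 3 * p.2) %/ 2)%Z, ((p.1 - p.2) %/ 2)%Z).
pose rho' (p : int * int) := (((- p.1 + 3 * p.2) %/ 2)%Z, ((- p.1 - p.2) %/ 2)%Z).
pose S p := if ev p then chi3 p.1 * p.1 else 0.
pose Z p := if ev p then chi3 p.1 * p.2 else 0.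
have -> : th2 8 24 (fun p => if ((p.1 + p.2) %% 2 == 1)%Z then 0 else chi3 p.1 * p.1)
  = th2 8 24 S.
  by apply: eq_th2 => p; rewrite /S /ev; case: ifP.
have Z0 : th2 8 24 Z = 0.
  apply: (@th2_odd 8 24 (fun p => (p.1, - p.2))) => // -[x y] /=;
    rewrite ?opprK ?sqrrN //.
  rewrite /Z /ev /=; have -> : ((x - y) %% 2 == 1)%Z = ((x + y) %% 2 == 1)%Z by lia.
  by case: ifP => _; ring.
have param p : ev p -> exists a b, p = (a, b) /\ exists u, a = b + 2 * u.
  case: p => a b; rewrite /ev /= => h; exists a, b; split=> //.
  by exists ((a - b) %/ 2)%Z; lia.
have rhoE b u : rho (b + 2 * u, b) = (- 2 * b - u, u) by rewrite /rho /=; congr (_, _);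
  lia.
have rho'E b u : rho' (b + 2 * u, b) = (b - u, - b - u) by rewrite /rho' /=;
  congr (_, _); lia.
have evE b u : ev (b + 2 * u, b) by rewrite /ev /=; lia.
have form b u : 8 * (- 2 * b - u) ^+ 2 + 24 * u ^+ 2
  = 8 * (b + 2 * u) ^+ 2 + 24 * b ^+ 2 :> int.
  by ring.
have rot b u : chi3 (b + 2 * u) = chi3 (- 2 * b - u).
  by rewrite /chi3; do !case: ifP => ? //=; lia.
pose S' p := if ev p then chi3 p.1 * ((- p.1 - 3 * p.2) %/ 2)%Z else 0.
have eS : th2 8 24 S' = th2 8 24 S.
  apply: (@th2_bij _ _ _ _ rho rho') => // p.
    rewrite /S'; case: ifP => [/param[a [b [-> [u ->]]]] _|]; last by rewrite eqxx.
    have e : - 2 * b - u = u + 2 * (- b - u) by ring.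
    rewrite rhoE form; split=> //; last by rewrite e rho'E; congr (_, _); ring.
    by rewrite /S e evE -e /= -rot; congr (_ * _); lia.
  rewrite /S; case: ifP => [/param[a [b [-> [u ->]]]] _|]; last by rewrite eqxx.
  have e : b - u = (- b - u) + 2 * b by ring.
  rewrite rho'E; split; last by rewrite e rhoE; congr (_, _); ring.
  rewrite /S' e evE -e /=; congr (_ * _); last by lia.
  by rewrite /chi3; do !case: ifP => ? //=; lia.
have e2 : 2%:R * th2 8 24 S' = - th2 8 24 S - 3%:R * th2 8 24 Z.
  rewrite !th2Mn th2N th2B; apply: eq_th2 => p; rewrite /S' /S /Z.
  case: ifP => [/param[a [b [-> [u ->]]]]|_]; last by ring.
  have -> /= : ((- (b + 2 * u, b).1 - 3 * (b + 2 * u, b).2) %/ 2)%Z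
    = - 2 * b - u by rewrite /=; lia.
  by ring.
apply: (@fps_mulf_eq0 3%:R); last exact: fps_natf_neq0.
transitivity (2%:R * th2 8 24 S' + th2 8 24 S); first by rewrite eS; ring.
by rewrite e2 Z0; ring.
Qed.

Lemma chi_rot z x : ((z + x) %% 2 == 1)%Z ->
  cong4 (z - 3 * x) (z + x) /\ chi3 (z - 3 * x) = chi3 z.
Proof. by move=> h; rewrite /cong4 /chi3; split; [lia|do !case: ifP => ? //=; lia]. Qed.

(** Multiplication by [1 + sqrt -3], which takes the norm form [z^2 + 3 x^2]
    to 4 times itself, identifies the pairs with [z + x] odd with the pairs of
    odd numbers [(m, y)] that are congruent modulo 4. Changing the sign of [m]
    shows that these are half of all odd pairs. *)
Lemma theta_eta_eta3_odd : V 2 theta_eta * V 2 theta_eta3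
  = 2%:R * th2 8 24 (fun p => if ((p.1 + p.2) %% 2 == 1)%Z then chi3 p.1 * p.1 else 0).
Proof.
rewrite /theta_eta /theta_eta3 !V_th // thM //.
pose B p := if cong4 p.1 p.2 then chi3 p.1 * p.2 else 0.
pose C p := if ((p.1 + p.2) %% 2 == 1)%Z then chi3 p.1 * (p.1 + p.2) else 0.
have Bs : th2 2 6 (fun p => B (- p.1, p.2)) = th2 2 6 B.
  by apply: (@th2_symm 2 6 (fun p => (- p.1, p.2))) => // -[x y] /=;
    rewrite ?opprK ?sqrrN.
have -> : th2 (2 * 1) (2 * 3) (fun p =>
  chi4 p.1 * chi3 p.1 * (chi4 p.2 * p.2)) = 2%:R * th2 2 6 B.
  rewrite mulr_natl mulr2n -{1}Bs th2D; apply: eq_th2 => -[x y] /=.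
  rewrite /B /= chi3N mulrACA; set w := _ * y.
  have -> : chi4 x * chi4 y = (if cong4 x y then 1 else 0) - (if cong4 (- x) y then 1
    else 0).
    by rewrite /chi4 /cong4; do !case: ifP => ? //=; lia.
  by rewrite /w; do 2!case: ifP => _; ring.
congr (_ * _).
have -> : th2 2 6 B = th2 8 24 C.
  apply/esym/(@th2_bij _ _ _ _ (fun p => (p.1 - 3 * p.2, p.1 + p.2))
    (fun p => (((p.1 + 3 * p.2) %/ 4)%Z, ((p.2 - p.1) %/ 4)%Z))) => // -[x y] /=.
    rewrite /C /B /=; case: ifP => [h _|]; last by rewrite eqxx.
    have [cg ->] := chi_rot h; rewrite cg; split=> //; last by ring.
    by congr (_, _); lia.
  rewrite /B /=; case: ifP => [cg _|]; last by rewrite eqxx.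
  have [u ->] : exists u, y = x + 4 * u.
    by exists ((y - x) %/ 4)%Z; move: cg; rewrite /cong4; lia.
  have -> : ((x + 3 * (x + 4 * u)) %/ 4)%Z = x + 3 * u by lia.
  have -> : ((x + 4 * u - x) %/ 4)%Z = u by lia.
  have h : ((x + 3 * u + u) %% 2 == 1)%Z by move: cg; rewrite /cong4; lia.
  have [_ c3] := chi_rot h; rewrite /C /= h -c3; split; last by congr (_, _); ring.
  by congr (chi3 _ * _); ring.
apply/eqP; rewrite -subr_eq0 th2B; apply/eqP.
apply: (@th2_odd 8 24 (fun p => (p.1, - p.2))) => // -[x y] /=; rewrite ?opprK ?sqrrN //.
rewrite /C /=; have -> : ((x - y) %% 2 == 1)%Z = ((x + y) %% 2 == 1)%Z by lia.
by case: ifP => _; ring.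
Qed.

Lemma theta_u_theta3 : 2%:R * (theta_u * theta3) = V 2 theta_eta * V 2 theta_eta3.
Proof.
rewrite theta_eta_eta3_odd; congr (_ * _);
  rewrite /theta_u /theta3 thM // -[RHS]addr0 -theta_u_even_eq0 th2D.
by apply: eq_th2 => p; case: ifP => _; rewrite mulr1 ?addr0 ?add0r.
Qed.

Lemma theta_us_theta4 : 2%:R * (theta_us * theta4) = - (V 2 theta_eta * V 2 theta_eta3).
Proof.
rewrite theta_eta_eta3_odd -mulrN; congr (_ * _); rewrite /theta_us /theta4 thM // th2N.
rewrite -[RHS]addr0 -theta_u_even_eq0 th2D; apply: eq_th2 => -[x y] /=.
have -> : sgnz x * chi3 x * x * sgnz y = (sgnz x * sgnz y) * (chi3 x * x) by ring.
have -> : sgnz x * sgnz y = if ((x + y) %% 2 == 1)%Z then -1 else 1.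
  by rewrite /sgnz; do !case: ifP => ? //=; lia.
by case: ifP => _; ring.
Qed.

(** Multiplication by [1 + sqrt -2] of norm 3: with [n = y - 4 x],
    [m = y + 2 x] one has [n^2 + 2 m^2 = 3 y^2 + 24 x^2], and the image
    consists of the pairs congruent modulo 3. The pairs with both coordinates
    divisible by 3 cancel by oddness. *)
Lemma theta_v_eta2 : theta_v * V 2 theta_eta = 2%:R * (theta_eta3 * theta4).
Proof.
rewrite /theta_v /theta_eta V_th // /theta_eta3 /theta4 !thM //.
pose G p := if (p.1 %% 2 == 1)%Z && ((p.1 - p.2) %% 3 == 0)%Z then chi4 p.2 * p.1 else 0.
have Gs : th2 1 2 (fun p => G (p.1, - p.2)) = th2 1 2 G.
  by apply: (@th2_symm 1 2 (fun p => (p.1, - p.2))) => // -[x y] /=;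
    rewrite ?opprK ?sqrrN.
have -> : th2 1 (2 * 1) (fun p => oddz p.1 * chi3 p.1 * p.1 * (chi4 p.2 * chi3 p.2))
  = 2%:R * th2 1 2 G.
  rewrite mulr_natl mulr2n -{2}Gs th2D; apply: eq_th2 => -[x y] /=.
  transitivity (oddz x * (chi3 x * chi3 y) * (chi4 y * x)); first by ring.
  have -> : chi3 x * chi3 y = (if ((x - y) %% 3 == 0)%Z then 1 else 0) - (if ((x
    + y) %% 3 == 0)%Z then 1 else 0).
    by rewrite /chi3; do !case: ifP => ? //=; lia.
  rewrite /G /oddz /= opprK chi4N; case: ifP => _ /=; last by ring.
  by do 2!case: ifP => _; ring.
congr (_ * _).
transitivity (th2 3 24 (fun p => chi4 p.1 * (p.1 - 4 * p.2) * sgnz p.2)); last first.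
  apply/eqP; rewrite -subr_eq0 th2B; apply/eqP.
  apply: (@th2_odd 3 24 (fun p => (p.1, - p.2))) => // -[x y] /=;
    rewrite ?opprK ?sqrrN ?sgnzN //.
  by ring.
have rot y x : chi4 (y + 2 * x) = chi4 y * sgnz x.
  by rewrite /chi4 /sgnz; do !case: ifP => ? //=; lia.
apply/esym/(@th2_bij _ _ _ _ (fun p => (p.1 - 4 * p.2, p.1 + 2 * p.2))
    (fun p => (((p.1 + 2 * p.2) %/ 3)%Z, ((p.2 - p.1) %/ 6)%Z))) => // -[x y] /=.
  move=> nz; have ox : (x %% 2 == 1)%Z.
    by move: nz; rewrite /chi4; do !case: ifP => ? //=; (lia || rewrite !mul0r eqxx //).
  split; [|by congr (_, _); lia|by ring].
  by rewrite /G /= ifT; [rewrite rot; ring|lia].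
rewrite /G /=; case: ifP => [/andP[ox cg]|]; last by rewrite eqxx.
move=> nz; have oy : (y %% 2 == 1)%Z.
  by move: nz; rewrite /chi4; do !case: ifP => ? //=; (lia || rewrite !mul0r eqxx //).
have [u ->] : exists u, y = x + 6 * u by exists ((y - x) %/ 6)%Z; lia.
have -> : ((x + 2 * (x + 6 * u)) %/ 3)%Z = x + 4 * u by lia.
have -> : ((x + 6 * u - x) %/ 6)%Z = u by lia.
split; last by congr (_, _); ring.
have -> : x + 6 * u = x + 4 * u + 2 * u by ring.
by rewrite rot; ring.
Qed.

(** * The q-binomial theorem *)

Section QBinomial.
Variables (R : comNzRingType) (q : R).

Fixpoint qbin (m j : nat) : R :=
  match m, j with
  | _, 0 => 1
  | 0, _.+1 => 0
  | m'.+1, j'.+1 => qbin m' j' + q ^+ j'.+1 * qbin m' j'.+1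
  end.

Lemma qbin0 m : qbin m 0 = 1. Proof. by case: m. Qed.
Lemma qbinS m j : qbin m.+1 j.+1 = qbin m j + q ^+ j.+1 * qbin m j.+1.
Proof. by []. Qed.
Arguments qbin : simpl never.
Lemma qbin_small m j : (m < j)%N -> qbin m j = 0.
Proof.
elim: m j => [|m IH] [|j] // h; rewrite qbinS !IH ?mulr0 ?addr0 //.
exact: ltnW.
Qed.

Definition qfact n : R := \prod_(k < n) (1 - q ^+ k.+1).
Lemma qfactS n : qfact n.+1 = qfact n * (1 - q ^+ n.+1).
Proof. by rewrite /qfact big_ord_recr. Qed.

Lemma qbin_fact m j : (j <= m)%N -> qbin m j * (qfact j * qfact (m - j)) = qfact m.
Proof.
elim: m j => [|m IH] [|j] //; first by rewrite qbin0 /qfact !big_ord0 !mul1r.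
  by move=> _; rewrite qbin0 {1}/qfact big_ord0 subn0 !mul1r.
rewrite ltnS subSS => jm; rewrite qbinS mulrDl.
have -> : qbin m j * (qfact j.+1 * qfact (m - j)) = qfact m * (1 - q ^+ j.+1).
  by rewrite -(IH j jm) qfactS; ring.
move: jm; rewrite leq_eqVlt => /predU1P[->|jm].
  by rewrite qbin_small // mulr0 mul0r addr0 qfactS.
have -> : (m - j = (m - j.+1).+1)%N by lia.
rewrite [qfact (_ - _).+1]qfactS; have -> : ((m - j.+1).+1 = m - j)%N by lia.
transitivity (qfact m * (1 - q ^+ j.+1)
    + q ^+ j.+1 * (qbin m j.+1 * (qfact j.+1 * qfact (m - j.+1))) * (1 - q ^+ (m - j))).
  by ring.
have e : q ^+ m.+1 = q ^+ j.+1 * q ^+ (m - j) by rewrite -exprD; congr (_ ^+ _); lia.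
by rewrite (IH j.+1 jm) qfactS e; ring.
Qed.

Lemma qbinomial (x y : R) m : \prod_(i < m) (x + y * q ^+ i)
  = \sum_(j < m.+1) qbin m j * q ^+ 'C(j, 2) * y ^+ j * x ^+ (m - j).
Proof.
elim: m y => [|m IH] y; first by rewrite big_ord0 big_ord_recl big_ord0 !mulr1 addr0.
rewrite big_ord_recl expr0 mulr1.
under eq_bigr => i _ do rewrite lift0 exprS mulrA.
rewrite IH; pose F j := qbin m j * q ^+ 'C(j, 2) * (y * q) ^+ j.
have Fl : F m.+1 = 0 by rewrite /F qbin_small // !mul0r.
transitivity (\sum_(j < m.+2) F j * x ^+ (m.+1 - j)
  + \sum_(j < m.+1) F j * y * x ^+ (m - j)).
  rewrite [X in _ = X + _]big_ord_recr /= Fl mul0r addr0 -big_split mulr_sumr /=.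
  apply: eq_bigr => -[j hj] _ /=; rewrite -/(F j) subSn // exprS; ring.
rewrite big_ord_recl [RHS]big_ord_recl -addrA -big_split /=.
congr (_ + _); first by rewrite /F qbin0 !expr0.
apply: eq_bigr => j _; rewrite /bump /= add1n subSS -mulrDl; congr (_ * _).
by rewrite /F binS bin1 qbinS !exprMn !exprS exprD; ring.
Qed.

End QBinomial.
Arguments qbin {R} q m j : simpl never.

(** * Congruences of power series and the Euler product *)

(** Congruence modulo [q^n]. *)
Definition eqm n (f g : fps) := forall i, (i < n)%N -> f i = g i.

Lemma eqm_refl n f : eqm n f f. Proof. by []. Qed.
Lemma eqm_sym n f g : eqm n f g -> eqm n g f.
Proof. by move=> h i /h. Qed.
Lemma eqm_trans n g f h : eqm n f g -> eqm n g h -> eqm n f h.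
Proof. by move=> a b i hi; rewrite a ?b. Qed.
Lemma eqm_le n m f g : (m <= n)%N -> eqm n f g -> eqm m f g.
Proof. by move=> mn h i im; apply: h; apply: leq_trans im mn. Qed.
(** Only lower coefficients of the factors enter a coefficient of the
    product. *)
Lemma eqmM n f f' g g' : eqm n f f' -> eqm n g g' -> eqm n (f * g) (f' * g').
Proof.
move=> a b i hi; rewrite !fcoefM; apply: eq_bigr => j _.
by rewrite a ?b // (leq_ltn_trans _ hi) ?leq_subr // -ltnS.
Qed.
Lemma eqmX n f g k : eqm n f g -> eqm n (f ^+ k) (g ^+ k).
Proof. by move=> h; elim: k => // k IH; rewrite !exprS; apply: eqmM. Qed.
Lemma eqm_mono n k f g : eqm n f g -> eqm (k + n) (fps_mono k * f) (fps_mono k * g).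
Proof.
move=> h i hi; rewrite !fcoef_monoM; case: ifP => // ki; apply: h.
by rewrite ltn_subLR.
Qed.
Lemma eqm_V n k f g : (0 < k)%N -> eqm n f g -> eqm (k * n) (V k f) (V k g).
Proof.
move=> k0 h i hi /=; case: ifP => // _; apply: h.
by rewrite ltn_divLR // mulnC.
Qed.
Lemma eqm_eq f g : (forall n, eqm n f g) -> f = g.
Proof. by move=> h; apply: fpsP => n; apply: (h n.+1). Qed.
Lemma eqm_cancel n (f g h : fps) : h 0%N = 1 -> eqm n (h * f) (h * g) -> eqm n f g.
Proof.
move=> h0 e; have := eqmM (@eqm_refl n (fps_inv h)) e.
by rewrite !mulrA ![fps_inv h * h]mulrC fps_mulfV // !mul1r.
Qed.

Definition euler := Fps qpoch.
(** The finite product [(q^M; q^M)_n]. *)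
Definition qpoch_fin M n : fps := qfact (fps_mono M) n.

Lemma qpoch_finE M n : qpoch_fin M n = \prod_(k < n) (1 - fps_mono (M * k.+1)).
Proof. by apply: eq_bigr => k _; rewrite monoX. Qed.

Lemma V_qpoch_fin j M n : (0 < j)%N -> V j (qpoch_fin M n) = qpoch_fin (j * M) n.
Proof.
move=> j0; rewrite !qpoch_finE; elim: n => [|n IH]; first by rewrite !big_ord0 V1.
by rewrite !big_ord_recr /= VM // IH VB V1 V_mono // mulnA.
Qed.

Lemma euler_qpoch_fin1 n : eqm n.+1 euler (qpoch_fin 1 n).
Proof.
move=> i; rewrite ltnS => hi; rewrite /= (qpochE hi) big_add1 /= big_mkord.
have -> : qpoch_fin 1 n = Fps (fun i => (\prod_(k < n) (1 - 'X^(k.+1)) : {poly rat})`_i).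
  rewrite qpoch_finE; elim: n {hi} => [|n IH].
    by rewrite !big_ord0; apply: fpsP => j /=; rewrite coef1.
  rewrite !big_ord_recr /= IH; apply: fpsP => j.
  rewrite fcoefM [RHS]/= coefM; apply: eq_bigr => k _; congr (_ * _).
  by rewrite fcoefB fcoef1 mul1n coefB coef1 coefXn.
by [].
Qed.

Lemma euler_qpoch_fin M n : (0 < M)%N -> eqm (M * n.+1) (V M euler) (qpoch_fin M n).
Proof.
move=> M0; have := eqm_V M0 (@euler_qpoch_fin1 n).
by rewrite V_qpoch_fin // muln1.
Qed.

Lemma euler0 : euler 0%N = 1. Proof. exact: qpoch0. Qed.
Lemma V_0 k f : V k f 0%N = f 0%N.
Proof. by rewrite /= dvdn0 div0n. Qed.
Lemma V_euler_neq0 M : V M euler != 0.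
Proof. by apply: (@fps_neq0 _ 0); rewrite V_0 euler0 oner_neq0. Qed.

(** The q-binomial coefficient tends to [1 / (q; q)_oo], with an error
    controlled by the distance of [j] to both ends. *)
Lemma qbin_euler M m j : (0 < M)%N -> (j <= m)%N ->
  eqm (M * (minn j (m - j)).+1) (qbin (fps_mono M) m j * V M euler) 1.
Proof.
move=> M0 jm; set P := V M euler; set r := minn _ _.
have ap n : (r <= n)%N -> eqm (M * r.+1) (qpoch_fin M n) P.
  by move=> rn; apply: eqm_le (eqm_sym (@euler_qpoch_fin M n M0));
    rewrite leq_mul2l ltnS rn orbT.
have P0 : P 0%N = 1 by rewrite V_0 euler0.
apply: (@eqm_cancel _ _ _ P P0); rewrite mulr1.
apply: (@eqm_trans _ (qbin (fps_mono M) m j * (qpoch_fin M j * qpoch_fin M (m - j)))).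
  rewrite mulrCA; apply: eqmM; first exact: eqm_refl.
  by apply: eqm_sym; apply: eqmM; apply: ap; rewrite /r (geq_minl, geq_minr).
by rewrite qbin_fact //; apply: ap; rewrite /r; lia.
Qed.

(** The series [sum_(s in Z) c(s) q^(e(s))]; the range of [s] is sufficient
    whenever [|s| <= e(s) + 1]. *)
Definition exp_series (c : int -> int) (e : int -> nat) : fps := Fps (fun n =>
  (\sum_(s <- zbox n.+1) if (e s == n)%N then c s else 0)%:~R).

Lemma exp_seriesE c e n i : (forall s, (`|s| <= (e s).+1)%N) -> (i < n)%N ->
  exp_series c e i = (\sum_(s <- zbox n) if (e s == i)%N then c s else 0)%:~R.
Proof.
move=> he hi /=; congr (_%:~R).
apply: (sum_bij (h := id) (h' := id)); try exact: zbox_uniq.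
- by move=> x; rewrite !mem_zbox => hx nz; split=> //; apply: leq_trans hx _.
move=> x _; case: ifP => [/eqP ex _|_]; last by rewrite eqxx.
by rewrite mem_zbox -ex; split=> //; apply: he.
Qed.

Lemma V_coef k f i : (0 < k)%N -> V k f (i * k)%N = f i.
Proof. by move=> k0; rewrite /= dvdn_mull // mulnK. Qed.

(** Completing the square: if [K e(s) + r = k (a s + b)^2], then the series
    becomes a theta series supported on the progression [a s + b]; [g]
    recovers [s] from an element of the support. *)
Lemma exp_series_th (c c' : int -> int) e K r k (a b : int) (g : int ->
  int) : (0 < K)%N -> (0 < k)%N ->
  (forall s, (`|s| <= (e s).+1)%N) ->
  (forall s, (K * e s + r)%N%:Z = k%:Z * (a * s + b) ^+ 2) ->
  (forall s, c' (a * s + b) = c s) -> (forall s, g (a * s + b) = s) ->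
  (forall x, c' x != 0 -> a * g x + b = x) ->
  fps_mono r * V K (exp_series c e) = th k c'.
Proof.
move=> K0 k0 he hq hc hg hg'; apply: fpsP => n; rewrite fcoef_monoM.
have hq' s : (K * e s + r)%N = (k * absz (a * s + b)%R ^ 2)%N.
  by apply/eqP; rewrite -eqz_nat hq PoszM sqr_absz.
transitivity ((\sum_(s <- zbox n.+1) if (K * e s + r == n)%N then c s else 0)%:~R : rat).
  have sh i : n = (K * i + r)%N -> (r <= n)%N /\ V K (exp_series c e) (n - r)%N
     = (\sum_(s <- zbox n.+1) if (K * e s + r == n)%N then c s else 0)%:~R.
    move=> hi; split; first by rewrite hi leq_addl.
    have -> : (n - r = i * K)%N by rewrite hi addnK mulnC.
    rewrite V_coef // (@exp_seriesE _ _ n.+1) //.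
      congr (_%:~R); apply: eq_bigr => s _.
      by rewrite hi eqn_add2r eqn_pmul2l.
    by rewrite hi ltnS (leq_trans _ (leq_addr _ _)) ?leq_pmull.
  have [h|h] := boolP [exists i : 'I_n.+1, n == (K * i + r)%N].
    by have [i /eqP /sh[-> ->]] := existsP h.
  have no i : n <> (K * i + r)%N.
    move=> e1; move/existsP: h; apply.
    have hi : (i < n.+1)%N by rewrite e1; nia.
    by exists (Ordinal hi); rewrite /= -e1.
  rewrite big1 => [|s _]; last by case: eqP => // e1; case: (no (e s)).
  case: leqP => // rn; rewrite /=; case: ifP => // /dvdnP[i e1].
  by case: (no i); rewrite mulnC -e1 subnK.
congr (_%:~R); apply: (sum_bij (h := fun s => a * s + b) (h' := g)); try exact: zbox_uniq.
  move=> s _; rewrite hq'; case: ifP => [/eqP e1 _|_]; last by rewrite eqxx.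
  by rewrite hc hg mem_zbox (leq_of_sqr k0) ?e1.
move=> x _; case: ifP => [/eqP e1 nz|_]; last by rewrite eqxx.
rewrite -hc hg' // hq' hg' // e1 eqxx mem_zbox; split=> //.
apply: leq_trans (he _) _; rewrite ltnS.
have := hq' (g x); rewrite hg' // e1 => <-.
by apply: leq_trans (leq_addr _ _); rewrite leq_pmull.
Qed.

(** * The Jacobi triple product *)

Definition tri (s : int) : int := ((s * (s - 1)) %/ 2)%Z.

Lemma triE s : 2 * tri s = s * (s - 1).
Proof.
rewrite /tri; have [u [->|->]] : exists u : int, s = 2 * u \/ s = 2 * u + 1.
- by exists (s %/ 2)%Z; lia.
- have -> : 2 * u * (2 * u - 1) = (u * (2 * u - 1)) * 2 by ring.
  by rewrite mulzK // mulrC.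
have -> : (2 * u + 1) * (2 * u + 1 - 1) = (u * (2 * u + 1)) * 2 by ring.
by rewrite mulzK // mulrC.
Qed.

(** The exponent [M s (s - 1) / 2 + A s] of the triple product. *)
Definition jacobi_exp M A (s : int) : nat := absz (M%:Z * tri s + A%:Z * s).

Lemma jacobi_expE M A s : (A <= M)%N ->
  2 * (jacobi_exp M A s)%:Z = M%:Z * (s * (s - 1)) + 2 * A%:Z * s
  /\ M%:Z * (`|s| * (`|s| - 1)) <= 2 * (jacobi_exp M A s)%:Z.
Proof.
move=> AM; have t := triE s.
have t2 : 2 * (M%:Z * tri s + A%:Z * s) = M%:Z * (s * (s - 1)) + 2 * A%:Z * s.
  by rewrite -t; ring.
have lo : M%:Z * (`|s| * (`|s| - 1)) <= M%:Z * (s * (s - 1)) + 2 * A%:Z * s.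
  case: (ltrP s 0) => s0; first by rewrite ltr0_norm //; nia.
  by rewrite ger0_norm //; nia.
have nn : 0 <= `|s| * (`|s| - 1) :> int by case: (eqVneq s 0) => [->|?] //; nia.
suff e : (jacobi_exp M A s)%:Z = M%:Z * tri s + A%:Z * s by rewrite e t2.
by rewrite abszE ger0_norm //; nia.
Qed.

Lemma quad_ge0 (t : int) : 0 <= (t - 1) * (t - 2).
Proof. by case: (lerP t 1) => h; nia. Qed.

Lemma jacobi_exp_bound M A s : (0 < M)%N -> (A <= M)%N ->
  (absz s <= (jacobi_exp M A s).+1)%N.
Proof.
move=> M0 AM; have [_ h] := jacobi_expE s AM; have q := quad_ge0 `|s|.
by rewrite -lez_nat; nia.
Qed.

(** The error term of [qbin_euler] is harmless in the sum over [s]: the factor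
    [q^(e(s))] compensates for the loss of precision when [|s|] grows. *)
Lemma jacobi_exp_far M A n (s : int) : (0 < M)%N -> (A <= M)%N -> (absz s <= n)%N ->
  (n <= jacobi_exp M A s + M * (n - absz s).+1)%N.
Proof.
move=> M0 AM sn; have [_ h] := jacobi_expE s AM; have q := quad_ge0 `|s|.
by rewrite -lez_nat PoszD PoszM -addn1 PoszD -subzn //; nia.
Qed.

Lemma prod_mono_bin M n : \prod_(i < n) fps_mono (M * i) = fps_mono (M * 'C(n, 2)).
Proof.
elim: n => [|n IH]; first by rewrite big_ord0 muln0.
by rewrite big_ord_recr /= IH -monoD binS bin1 mulnDr addnC.
Qed.

Lemma bin2_double k : 2 * ('C(k, 2))%:Z = k%:Z * (k%:Z - 1).
Proof.
have := bin2 k; have := odd_double_half (k * k.-1)%N; rewrite oddM.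
by case: k => [|k] //=; nia.
Qed.

Lemma triple_product_exponent M A n j : (A <= M)%N -> (0 < n)%N -> (j <= n + n)%N ->
  (M * 'C(j, 2) + (M * n - A) * (n + n - j)
   = M * 'C(n, 2) + n * (M * n - A) + jacobi_exp M A (j%:Z - n%:Z))%N.
Proof.
move=> AM n0 jn; have [e _] := jacobi_expE (j%:Z - n%:Z) AM.
have b := bin2_double.
have AMn : (A <= M * n)%N by nia.
apply/eqP; rewrite -eqz_nat !PoszD !PoszM -!subzn //; apply/eqP.
apply: (@mulfI _ (2 : int)) => //.
transitivity (M%:Z * (2 * 'C(j, 2)%:Z) + 2 * (M%:Z * n%:Z - A%:Z) * (n%:Z + n%:Z - j%:Z)).
  by rewrite PoszM PoszD; ring.
transitivity (M%:Z * (2 * 'C(n, 2)%:Z) + 2 * n%:Z * (M%:Z * n%:Z - A%:Z)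
  + 2 * (jacobi_exp M A (j%:Z - n%:Z))%:Z).
  by rewrite e !b; ring.
by rewrite PoszM; ring.
Qed.

(** The q-binomial theorem for [2 n] factors at [x = q^(M n - A)], [y = eps]:
    the first [n] factors give the product with [M - A], the last [n] the
    product with [A]. *)
Lemma finite_triple_product (eps : fps) M A n : eps * eps = 1 -> (A <= M)%N ->
  \prod_(k < n) ((1 + eps * fps_mono (M * k + A)) * (1 + eps * fps_mono (M * k
    + (M - A))))
  = \sum_(j < (n + n).+1) eps ^+ (n + j) * qbin (fps_mono M) (n + n) j
      * fps_mono (jacobi_exp M A (j%:Z - n%:Z)).
Proof.
move=> ee AM; case: n => [|n'].
  rewrite big_ord0 big_ord_recl big_ord0 addr0 /= qbin0 !mul1r subrr.
  by rewrite /jacobi_exp /tri !mulr0.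
set n := n'.+1; have n0 : (0 < n)%N by [].
have eX k : eps ^+ (k + k) = 1 by rewrite addnn -mul2n exprM expr2 ee expr1n.
pose K := (M * 'C(n, 2) + n * (M * n - A))%N.
have := qbinomial (fps_mono M) (fps_mono (M * n - A)) eps (n + n).
rewrite big_split_ord /=.
have -> : \prod_(i < n) (fps_mono (M * n - A) + eps * fps_mono M ^+ i)
   = eps ^+ n * fps_mono (M * 'C(n, 2)) * \prod_(i < n) (1 + eps * fps_mono (M * i
     + (M - A))).
  rewrite [X in _ = _ * X](reindex_inj rev_ord_inj) /=.
  rewrite -prod_mono_bin -[n in eps ^+ n](card_ord n) -prodr_const -!big_split /=.
  apply: eq_bigr => -[i hi] _ /=; rewrite monoX mulrDr mulr1 addrC; congr (_ + _).
  rewrite mulrACA ee mul1r -monoD; congr fps_mono.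
  have h : (i.+1 <= n)%N by [].
  by rewrite mulnBr; nia.
have -> : \prod_(i < n) (fps_mono (M * n - A) + eps * fps_mono M ^+ (n + i))
   = fps_mono (n * (M * n - A)) * \prod_(i < n) (1 + eps * fps_mono (M * i + A)).
  rewrite [(n * (_ - _))%N]mulnC -monoX -[n in fps_mono _ ^+ n](card_ord n)
    -prodr_const -!big_split /=.
  apply: eq_bigr => -[i hi] _ /=; rewrite monoX mulrDr mulr1; congr (_ + _).
  by rewrite mulrCA -monoD; congr (_ * fps_mono _); nia.
set F1 := \prod_(i < n) _; set F2 := \prod_(i < n) _ => main.
rewrite big_split /= -/F1 -/F2.
apply: (@fps_mulfI (fps_mono K)); first exact: mono_neq0.
transitivity (eps ^+ n * (eps ^+ n * fps_mono (M * 'C(n, 2)) * F1 * (fps_mono (n * (M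
  * n - A)) * F2))).
  have -> : fps_mono K * (F2 * F1) = (eps ^+ (n
    + n)) * (fps_mono K * (F2 * F1)) by rewrite eX mul1r.
  by rewrite /K monoD exprD; ring.
rewrite main !mulr_sumr; apply: eq_bigr => -[j /=]; rewrite ltnS => hj _.
rewrite !monoX exprD.
transitivity (eps ^+ n * (eps ^+ j * qbin (fps_mono M) (n
  + n) j) * (fps_mono (M * 'C(j, 2)) * fps_mono ((M * n - A) * (n + n - j)))).
  by ring.
by rewrite -monoD (triple_product_exponent AM n0 hj) -/K monoD; ring.
Qed.

(** Passage to the limit [n -> oo] in a finite identity of the shape of
    [finite_triple_product], modulo [q^n]. *)
Lemma exp_series_lim n (c : int -> int) (e : int -> nat) (f : fps) (u : nat -> fps) m :
  (forall s, (absz s <= (e s).+1)%N) ->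
  (forall j, (j <= m)%N -> eqm n (u j
    * fps_mono (e (j%:Z - n%:Z)%R)) (fps_mono (e (j%:Z - n%:Z)%R))) ->
  (n + n <= m)%N -> (forall j, (n + n < j)%N -> (n <= e (j%:Z - n%:Z)%R)%N) ->
  f = \sum_(j < m.+1) (c (j%:Z - n%:Z))%:~R * u j * fps_mono (e (j%:Z - n%:Z)%R) ->
  eqm n f (exp_series c e).
Proof.
move=> he hu nm far -> i hi; rewrite (@exp_seriesE _ _ n) // fcoef_sum /=.
rewrite rmorph_sum /= big_map.
have -> : \sum_(j < m.+1) ((c (j%:Z - n%:Z))%:~R * u j * fps_mono (e (j%:Z - n%:Z)%R)) i
   = \sum_(j < m.+1) (if e (j%:Z - n%:Z)%R == i then c (j%:Z - n%:Z) else 0)%:~R.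
  apply: eq_bigr => j _; have hj : (j <= m)%N by rewrite -ltnS.
  by rewrite -mulrA mulrzl fcoefMz hu // -fcoefMz fcoef_monoMz.
rewrite -(big_mkord xpredT (fun j => (if e (j%:Z - n%:Z)%R == i then c (j%:Z - n%:Z)
  else 0)%:~R)).
have nm' : ((n.*2).+1 <= m.+1)%N by rewrite ltnS -addnn.
rewrite (big_cat_nat (leq0n _) nm') /= [X in _ + X]big_nat_cond [X in _ + X]big1 ?addr0.
  by rewrite /index_iota subn0.
move=> j /andP[/andP[h _] _]; case: eqP => // e1.
have := far j; rewrite e1 addnn => /(_ h); lia.
Qed.

Lemma triple_product (b : bool) M A n : (0 < M)%N -> (A <= M)%N ->
  eqm n (\prod_(k < n) ((1 + (-1) ^+ b * fps_mono (M * k + A))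
                        * (1 + (-1) ^+ b * fps_mono (M * k + (M - A)))) * V M euler)
        (exp_series (fun s => (-1) ^+ (b && odd (absz s))) (jacobi_exp M A)).
Proof.
move=> M0 AM.
have ee : (-1) ^+ b * (-1) ^+ b = 1 :> fps by rewrite -exprD addnn -mul2n exprM sqrrN
  expr1n expr1n.
rewrite finite_triple_product //.
apply: (@exp_series_lim n _ _ _ (fun j =>
  qbin (fps_mono M) (n + n) j * V M euler) (n + n)) => //.
- by move=> s; apply: jacobi_exp_bound.
- move=> j hj; rewrite mulrC -[X in eqm _ _ X]mulr1.
  have far : (absz (j%:Z - n%:Z) <= n)%N by lia.
  apply: eqm_le (jacobi_exp_far M0 AM far) _; apply: eqm_mono.
  apply: eqm_le (qbin_euler M0 hj); rewrite leq_mul2l; lia.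
- by move=> j h; have := jacobi_exp_bound (j%:Z - n%:Z) M0 AM; lia.
rewrite mulr_suml; apply: eq_bigr => -[j /=]; rewrite ltnS => hj _.
rewrite -exprM.
have -> : ((-1) ^+ (b * (n + j)))%R
  = ((-1) ^+ (b && odd (absz (j%:Z - n%:Z))))%:~R :> fps.
  rewrite rmorphXn rmorphN /= -signr_odd oddM; congr (_ ^+ _).
  have -> : odd (absz (j%:Z - n%:Z)) = odd (n + j) by lia.
  by case: b {ee}.
by ring.
Qed.

(** * The cube of the Euler product *)

Lemma qbin_polyC (R : comNzRingType) (q : R) m j : qbin q%:P m j = (qbin q m j)%:P.
Proof.
elim: m j => [|m IH] [|j]; rewrite ?qbin0 //.
by rewrite !qbinS !IH polyCD polyCM rmorphXn.
Qed.

(** The q-binomial theorem at [y = -1] as an identity of polynomials in [x],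
    differentiated and evaluated at the root [x = q^n]. *)
Lemma qbinomial_deriv (R : comNzRingType) (q : R) n :
  (\prod_(i < n) (q ^+ n - q ^+ i)) * \prod_(i < n) (q ^+ n - q ^+ (n + i.+1))
  = \sum_(j < (n + n).+2) qbin q (n + n).+1 j * q ^+ 'C(j, 2) * (-1) ^+ j
     * (q ^+ (n * (n + n - j)) *+ ((n + n).+1 - j))
  /\ \sum_(j < (n + n).+2) qbin q (n + n).+1 j * q ^+ 'C(j, 2) * (-1) ^+ j
     * q ^+ (n * ((n + n).+1 - j)) = 0.
Proof.
have := qbinomial q%:P 'X (-1) (n + n).+1; rewrite -addnS big_split_ord big_ord_recl /=.
rewrite addn0.
set A := \prod_(i < n) _; set B := \prod_(i < n) _; set x0 := 'X + _.
have x0E : x0 = 'X - (q ^+ n)%:P by rewrite /x0 mulN1r rmorphXn.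
have hX c (i : nat) : ('X + -1 * (q%:P) ^+ i : {poly R}).[c] = c - q ^+ i.
  by rewrite mulN1r -rmorphXn /= hornerD hornerX hornerN hornerC.
have hA : A.[q ^+ n] = \prod_(i < n) (q ^+ n - q ^+ i).
  by rewrite /A horner_prod; apply: eq_bigr => i _; rewrite hX.
have hB : B.[q ^+ n] = \prod_(i < n) (q ^+ n - q ^+ (n + i.+1)).
  by rewrite /B horner_prod; apply: eq_bigr => i _; rewrite hX.
have term j k : qbin q%:P (n + n.+1) j * q%:P ^+ 'C(j, 2) * (-1) ^+ j * 'X^k
   = (qbin q (n + n.+1) j * q ^+ 'C(j, 2) * (-1) ^+ j)%:P * 'X^k :> {poly R}.
  by rewrite qbin_polyC !polyCM !rmorphXn /= rmorphN1.
under [X in _ = X]eq_bigr => j _ do rewrite term.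
have x00 : x0.[q ^+ n] = 0 by rewrite x0E !hornerE subrr.
rewrite -hA -hB => main; split.
  have := congr1 (fun p : {poly R} => (p^`()).[q ^+ n]) main.
  have x01 : x0^`() = 1 by rewrite x0E derivXsubC.
  rewrite !derivM x01 hornerD hornerM [(x0 * B).[_]]hornerM x00 mul0r mulr0 add0r.
  rewrite hornerM hornerD !hornerM hornerC x00 mul0r addr0 mul1r => ->.
  rewrite raddf_sum horner_sum /=; apply: eq_bigr => j _.
  rewrite derivM derivC mul0r add0r derivXn hornerM hornerC hornerMn hornerXn.
  by rewrite -exprM; congr (_ * (_ ^+ (_ * _) *+ _)); lia.
have := congr1 (fun p : {poly R} => p.[q ^+ n]) main.
rewrite hornerM [(x0 * B).[_]]hornerM x00 mul0r mulr0 horner_sum => e; rewrite [RHS]e.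
by apply: eq_bigr => j _; rewrite hornerM hornerC hornerXn -exprM.
Qed.

(** In [qbinomial_deriv] the derivative brings down the factor [(n + 1) - s]
    with [s = j - n]; the constant part [n + 1] disappears because the
    undifferentiated sum vanishes. *)
Lemma jacobi_fin n : qpoch_fin 1 n ^+ 2
  = \sum_(j < (n + n).+2) ((- (-1) ^+ odd (absz (j%:Z - n%:Z)%R) * (j%:Z - n%:Z))%:~R
       * qbin (fps_mono 1) (n + n).+1 j) * fps_mono (jacobi_exp 1 0 (j%:Z - n%:Z)%R).
Proof.
have mX k : fps_mono 1 ^+ k = fps_mono k by rewrite monoX mul1n.
have [main zero] := qbinomial_deriv (fps_mono 1) n.
(* the power of the variable common to all terms *)
pose K := ('C(n, 2) + n * n)%N.
have b := bin2_double.
have sh j : (j <= n + n)%N -> ('C(j, 2) + n * (n + n - j)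
  = K + jacobi_exp 1 0 (j%:Z - n%:Z)%R)%N.
  move=> hj; have [e _] := jacobi_expE (j%:Z - n%:Z) (leq0n 1); have bj := b j;
    have bn := b n.
  apply/eqP; rewrite -eqz_nat !PoszD !PoszM -!subzn // ?PoszD; apply/eqP.
  apply: (@mulfI _ (2 : int)) => //.
  by rewrite !mulrDr e bj bn; ring.
have sh1 j : (j <= (n + n).+1)%N -> ('C(j, 2) + n * ((n + n).+1 - j)
  = K + n + jacobi_exp 1 0 (j%:Z - n%:Z)%R)%N.
  move=> hj; have [e _] := jacobi_expE (j%:Z - n%:Z) (leq0n 1); have bj := b j;
    have bn := b n.
  apply/eqP; rewrite -eqz_nat !PoszD !PoszM -!subzn // -[(n + n).+1]addn1 !PoszD;
    apply/eqP.
  apply: (@mulfI _ (2 : int)) => //.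
  by rewrite !mulrDr e bj bn; ring.
have lhs : (\prod_(i < n) (fps_mono 1 ^+ n - fps_mono 1 ^+ i))
    * \prod_(i < n) (fps_mono 1 ^+ n - fps_mono 1 ^+ (n + i.+1))
    = (-1) ^+ n * fps_mono K * qpoch_fin 1 n ^+ 2.
  have -> : \prod_(i < n) (fps_mono 1 ^+ n - fps_mono 1 ^+ i)
     = (-1) ^+ n * fps_mono 'C(n, 2) * qpoch_fin 1 n.
    rewrite qpoch_finE [X in _ = _ * X](reindex_inj rev_ord_inj) /=.
    have := prod_mono_bin 1 n; rewrite mul1n => <-.
    rewrite -[n in (-1) ^+ n](card_ord n) -prodr_const -!big_split /=.
    apply: eq_bigr => -[i hi] _ /=; rewrite !mX !mul1n.
    have {1}-> : n = (i + (n - i.+1).+1)%N by lia.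
    by rewrite monoD; ring.
  have -> : \prod_(i < n) (fps_mono 1 ^+ n - fps_mono 1 ^+ (n + i.+1))
    = fps_mono (n * n) * qpoch_fin 1 n.
    rewrite qpoch_finE -monoX -[X in _ = _ ^+ X * _](card_ord n) -[X in _
      = X * _]prodr_const -!big_split /=.
    by apply: eq_bigr => i _; rewrite !mX mul1n monoD; ring.
  by rewrite /K monoD; ring.
pose q j := qbin (fps_mono 1) (n + n).+1 j.
pose e j := fps_mono (jacobi_exp 1 0 (j%:Z - n%:Z)%R).
have z0 : \sum_(j < (n + n).+2) (-1) ^+ j * q j * e j = 0.
  apply: (@fps_mulfI (fps_mono (K + n))); first exact: mono_neq0.
  rewrite mulr0 -[RHS]zero mulr_sumr; apply: eq_bigr => j _.
  have hj : (j <= (n + n).+1)%N by rewrite -ltnS.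
  rewrite !mX /q /e; set Q := qbin _ _ _.
  transitivity ((-1) ^+ j * Q * (fps_mono ('C(j, 2)) * fps_mono (n * ((n
    + n).+1 - j)))); last by ring.
  by rewrite -monoD sh1 // [fps_mono (K + n + _)]monoD; ring.
have m1 : \sum_(j < (n + n).+2) (-1) ^+ j * q j * e j * ((n + n).+1 - j)%:R
  = (-1) ^+ n * qpoch_fin 1 n ^+ 2.
  apply: (@fps_mulfI (fps_mono K)); first exact: mono_neq0.
  rewrite mulrCA [RHS]mulrA -lhs main mulr_sumr; apply: eq_bigr => j _.
  have : (j <= (n + n).+1)%N by rewrite -ltnS.
  rewrite leq_eqVlt => /predU1P[->|hj]; first by rewrite subnn mulr0n !mulr0.
  rewrite !mX /q /e -mulr_natr; set Q := qbin _ _ _.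
  transitivity ((-1) ^+ j * Q * (fps_mono ('C(j, 2)) * fps_mono (n * (n
    + n - j))) * ((n + n).+1 - j)%:R); last by ring.
  by rewrite -monoD sh // [fps_mono (K + _)]monoD; ring.
have ee : (-1) ^+ n * (-1) ^+ n = 1 :> fps by rewrite -exprD addnn -mul2n exprM sqrrN
  !expr1n.
transitivity ((-1) ^+ n * (\sum_(j < (n + n).+2) (-1) ^+ j * q j * e j * ((n
  + n).+1 - j)%:R)
    - (-1) ^+ n * n.+1%:R * \sum_(j < (n + n).+2) (-1) ^+ j * q j * e j).
  by rewrite z0 mulr0 subr0 m1 mulrA ee mul1r.
rewrite !mulr_sumr -sumrB; apply: eq_bigr => j _.
have hj : (j <= (n + n).+1)%N by rewrite -ltnS.
rewrite -/(q j) -/(e j).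
have -> : (- (-1) ^+ odd (absz (j%:Z - n%:Z)%R) * (j%:Z - n%:Z))%:~R
   = - ((-1) ^+ n * (-1) ^+ j) * (j%:R - n%:R) :> fps.
  rewrite rmorphM rmorphN rmorphXn rmorphN1 /= rmorphB /=; congr (- _ * _).
  by rewrite -exprD -[RHS]signr_odd; congr (_ ^+ _); congr nat_of_bool; lia.
have e1 : (n + n).+1%:R = n%:R + n%:R + 1 :> fps by rewrite -addn1 !natrD.
have e2 : n.+1%:R = n%:R + 1 :> fps by rewrite -addn1 natrD.
by rewrite natrB // e1 e2; ring.
Qed.

(** Jacobi: [(q; q)_oo^3 = - sum_s (-1)^s s q^(s (s - 1) / 2)]. *)
Lemma jacobi_identity : exp_series (fun s =>
  - (-1) ^+ odd (absz s) * s) (jacobi_exp 1 0) = euler ^+ 3.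
Proof.
apply: eqm_eq => n; apply: (@eqm_trans _ (qpoch_fin 1 n ^+ 2 * V 1 euler)); last first.
  have e1 : V 1 euler = euler by apply: fpsP => i; rewrite /= dvd1n divn1.
  rewrite e1 [euler ^+ 3]exprSr; apply: eqmM; last exact: eqm_refl.
  apply: eqmX; apply: eqm_sym; apply: eqm_le (@euler_qpoch_fin1 n).
  exact: leqnSn.
apply: eqm_sym.
apply: (@exp_series_lim n _ _ _ (fun j =>
  qbin (fps_mono 1) (n + n).+1 j * V 1 euler) (n + n).+1) => //.
- by move=> s; apply: jacobi_exp_bound.
- move=> j hj; rewrite mulrC -[X in eqm _ _ X]mulr1.
  have [far|far] := leqP (absz (j%:Z - n%:Z)%R) n.
    apply: eqm_le (@jacobi_exp_far 1 0 n _ _ _ far) _ => //; apply: eqm_mono.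
    apply: eqm_le (qbin_euler (ltnSn 0) hj); rewrite leq_mul2l; lia.
  apply: (@eqm_le (jacobi_exp 1 0 (j%:Z - n%:Z)%R + 0)).
    have := @jacobi_exp_bound 1 0 (j%:Z - n%:Z) isT isT; lia.
  exact: eqm_mono.
- by move=> j h; have := @jacobi_exp_bound 1 0 (j%:Z - n%:Z) isT isT; lia.
by rewrite jacobi_fin mulr_suml; apply: eq_bigr => j _; ring.
Qed.

(** * Theta constants as eta quotients *)

Definition jacobi_series (b : bool) M A := exp_series (fun s =>
  (-1) ^+ (b && odd (absz s))) (jacobi_exp M A).

Lemma euler_eqm M k n : (0 < M)%N -> (n <= k)%N -> eqm n (V M euler) (qpoch_fin M k).
Proof.
move=> M0 nk; apply: eqm_le (@euler_qpoch_fin M k M0).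
by apply: leq_trans (leq_pmull _ M0); apply: leqW.
Qed.
Lemma V1E f : V 1 f = f. Proof. by apply: fpsP => i; rewrite /= dvd1n divn1. Qed.
Lemma euler_eqm1 k n : (n <= k)%N -> eqm n euler (qpoch_fin 1 k).
Proof. by move=> nk; rewrite -[euler]V1E; apply: euler_eqm. Qed.

Definition pochm (b : bool) M A n : fps := \prod_(k < n) (1
  + (-1) ^+ b * fps_mono (M * k + A)).
Lemma pochmS b M A n : pochm b M A n.+1
  = pochm b M A n * (1 + (-1) ^+ b * fps_mono (M * n + A)).
Proof. by rewrite /pochm big_ord_recr. Qed.
Lemma qpoch_finS M n : qpoch_fin M n.+1 = qpoch_fin M n * (1 - fps_mono (M * n.+1)).
Proof. by rewrite /qpoch_fin qfactS monoX. Qed.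
Lemma qpoch_fin0 M : qpoch_fin M 0 = 1. Proof. by rewrite /qpoch_fin /qfact big_ord0. Qed.
Lemma pochm0 b M A : pochm b M A 0 = 1. Proof. by rewrite /pochm big_ord0. Qed.

Lemma jacobi_series_eqm b M A n : (0 < M)%N -> (A <= M)%N ->
  eqm n (jacobi_series b M A) (pochm b M A n * pochm b M (M - A) n * V M euler).
Proof.
move=> M0 AM; apply: eqm_sym; apply: eqm_trans (@triple_product b M A n M0 AM).
by rewrite big_split.
Qed.

Lemma poch_odd n : pochm true 2 1 n * qpoch_fin 2 n = qpoch_fin 1 (n + n).
Proof.
elim: n => [|n IH]; first by rewrite pochm0 !qpoch_fin0 mulr1.
rewrite addnS addSn !qpoch_finS pochmS -IH !mul1n.
have -> : (n + n).+2 = (2 * n.+1)%N by lia.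
have -> : (n + n).+1 = (2 * n + 1)%N by lia.
by ring.
Qed.

Lemma poch_even n : pochm false 2 2 n * qpoch_fin 2 n = qpoch_fin 4 n.
Proof.
elim: n => [|n IH]; first by rewrite pochm0 !qpoch_fin0 mulr1.
rewrite !qpoch_finS pochmS -IH.
have -> : fps_mono (4 * n.+1) = fps_mono (2 * n.+1) ^+ 2 by rewrite monoX;
  congr fps_mono; lia.
have -> : (2 * n + 2)%N = (2 * n.+1)%N by lia.
by ring.
Qed.

Lemma poch_even0 n : pochm false 2 0 n.+1 = 2%:R * pochm false 2 2 n.
Proof.
rewrite /pochm big_ord_recl /= mono0; congr (_ * _); first by ring.
by apply: eq_bigr => i _; rewrite /bump /=; congr (1 + _ * fps_mono _); lia.
Qed.

Lemma poch_pm n : pochm false 2 1 n * pochm true 2 1 n * qpoch_fin 4 n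
  = qpoch_fin 2 (n + n).
Proof.
elim: n => [|n IH]; first by rewrite !pochm0 !qpoch_fin0 !mulr1.
rewrite addnS addSn !qpoch_finS !pochmS -IH.
have -> : fps_mono (2 * (n + n).+1) = fps_mono (2 * n + 1) ^+ 2.
  by rewrite monoX; congr fps_mono; lia.
have -> : (2 * (n + n).+2)%N = (4 * n.+1)%N by lia.
by ring.
Qed.

Lemma poch_third n : pochm true 3 1 n * pochm true 3 2 n * qpoch_fin 3 n
  = qpoch_fin 1 (n + n + n).
Proof.
elim: n => [|n IH]; first by rewrite !pochm0 !qpoch_fin0 !mulr1.
rewrite !addnS !addSn !qpoch_finS !pochmS -IH !mul1n.
have -> : (n + n + n).+3 = (3 * n.+1)%N by lia.
have -> : (n + n + n).+2 = (3 * n + 2)%N by lia.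
have -> : (n + n + n).+1 = (3 * n + 1)%N by lia.
by ring.
Qed.

Lemma gauss_theta4 : jacobi_series true 2 1 * V 2 euler = euler ^+ 2.
Proof.
apply: eqm_eq => n; apply: eqm_trans (eqmM (@jacobi_series_eqm true 2 1 n isT isT)
  (@eqm_refl n _)) _.
apply: (@eqm_trans _ ((pochm true 2 1 n * qpoch_fin 2 n) ^+ 2)).
  have -> : pochm true 2 1 n * pochm true 2 1 n * V 2 euler * V 2 euler
     = (pochm true 2 1 n * V 2 euler) ^+ 2 by ring.
  by apply: eqmX; apply: eqmM; [apply: eqm_refl | apply: euler_eqm].
rewrite poch_odd; apply: eqmX; apply: eqm_sym; apply: euler_eqm1; exact: leq_addr.
Qed.

Lemma gauss_theta2 : jacobi_series false 2 0 * V 2 euler = 2%:R * V 4 euler ^+ 2.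
Proof.
apply: eqm_eq => -[|n] //.
apply: eqm_trans (eqmM (@jacobi_series_eqm false 2 0 n.+1 isT isT) (@eqm_refl n.+1 _)) _.
rewrite poch_even0 subn0.
have -> : 2%:R * pochm false 2 2 n * pochm false 2 2 n.+1 * V 2 euler * V 2 euler
  = 2%:R * (pochm false 2 2 n * V 2 euler * (pochm false 2 2 n.+1 * V 2 euler)) by ring.
apply: eqmM; first exact: eqm_refl.
have ap m : (n <= m)%N -> eqm n.+1 (pochm false 2 2 m * V 2 euler) (V 4 euler).
  move=> nm; apply: (@eqm_trans _ (qpoch_fin 4 m)).
    rewrite -poch_even; apply: eqmM; first exact: eqm_refl.
    by apply: eqm_le (@euler_qpoch_fin 2 m isT); lia.
  by apply: eqm_sym; apply: eqm_le (@euler_qpoch_fin 4 m isT); lia.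
by rewrite expr2; apply: eqmM; apply: ap; rewrite ?leqnSn.
Qed.

Lemma gauss_theta34 : jacobi_series false 2 1 * jacobi_series true 2 1
  * V 4 euler ^+ 2 = V 2 euler ^+ 4.
Proof.
apply: eqm_eq => n.
apply: eqm_trans (eqmM (eqmM (@jacobi_series_eqm false 2 1 n isT isT)
  (@jacobi_series_eqm true 2 1 n isT isT)) (@eqm_refl n _)) _.
have -> : pochm false 2 1 n * pochm false 2 (2 - 1) n * V 2 euler *
   (pochm true 2 1 n * pochm true 2 (2 - 1) n * V 2 euler) * V 4 euler ^+ 2
  = (pochm false 2 1 n * pochm true 2 1 n * V 4 euler) ^+ 2 * V 2 euler ^+ 2 by ring.
rewrite -[4%N]/(2 + 2)%N exprD; apply: eqmM; last exact: eqm_refl.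
apply: eqmX; apply: (@eqm_trans _ (qpoch_fin 2 (n + n))); last first.
  by apply: eqm_sym; apply: euler_eqm => //; apply: leq_addr.
by rewrite -poch_pm; apply: eqmM; [apply: eqm_refl | apply: euler_eqm].
Qed.

Lemma euler_pentagonal : jacobi_series true 3 1 = euler.
Proof.
apply: eqm_eq => n; apply: eqm_trans (@jacobi_series_eqm true 3 1 n isT isT) _.
apply: (@eqm_trans _ (qpoch_fin 1 (n + n + n))); last first.
  by apply: eqm_sym; apply: euler_eqm1; lia.
by rewrite -poch_third; apply: eqmM; [apply: eqm_refl | apply: euler_eqm].
Qed.

Definition eta := fps_mono 1 * V 24 euler.

Lemma V_eta k : (0 < k)%N -> V k eta = fps_mono k * V (k * 24) euler.
Proof. by move=> k0; rewrite /eta VM // V_mono // muln1 V_V. Qed.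

Lemma thetaE b : V 24 (jacobi_series b 2 1) = th 24 (fun x =>
  (-1) ^+ (b && odd (absz x))).
Proof.
rewrite -[LHS]mul1r -mono0.
apply: (@exp_series_th _ _ _ _ _ _ 1 0 id) => // [s|s|s|s|x _];
  try by rewrite mul1r addr0.
- exact: jacobi_exp_bound.
- have [e _] := @jacobi_expE 2 1 s isT; rewrite addn0 PoszM;
  apply: (@mulfI _ (2 : int)) => //.
  by rewrite mulrCA e; ring.
Qed.

Lemma theta3E : theta3 = V 24 (jacobi_series false 2 1).
Proof. by rewrite thetaE; apply: eq_th. Qed.
Lemma theta4E : theta4 = V 24 (jacobi_series true 2 1).
Proof.
rewrite thetaE; apply: eq_th => x; rewrite /sgnz /=.
by case: ifP => h; [have -> : odd (absz x) by lia|have -> : odd (absz x) = false by lia].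
Qed.
Lemma theta2E : theta2 = fps_mono 6 * V 24 (jacobi_series false 2 0).
Proof.
apply/esym/(@exp_series_th _ _ _ _ _ _ 2 (-1) (fun x => ((x + 1) %/ 2)%Z)) =>
  // [s|s|s|s|x].
- exact: jacobi_exp_bound.
- have [e _] := @jacobi_expE 2 0 s isT; rewrite PoszD PoszM;
  apply: (@mulfI _ (2 : int)) => //.
  by rewrite mulrDr mulrCA e; ring.
- by rewrite /oddz; case: ifP => //; lia.
- lia.
- by rewrite /oddz; case: ifP => //; lia.
Qed.

Lemma theta4_eta : theta4 * V 2 eta = eta ^+ 2.
Proof.
rewrite theta4E V_eta // /eta exprMn monoX.
by have := congr1 (V 24) gauss_theta4; rewrite VM // VX // V_V // => <-; ring.
Qed.

Lemma theta2_eta : theta2 * V 2 eta = 2%:R * V 4 eta ^+ 2.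
Proof.
rewrite theta2E !V_eta // exprMn monoX.
have := congr1 (V 24) gauss_theta2.
rewrite VM // [V 24 (2%:R * _)]VM // V_nat VX // !V_V // => e.
rewrite mulrACA -monoD [V 24 _ * _]e; ring.
Qed.

Lemma theta34_eta : theta3 * theta4 * V 4 eta ^+ 2 = V 2 eta ^+ 4.
Proof.
rewrite theta3E theta4E !V_eta // !exprMn !monoX.
have := congr1 (V 24) gauss_theta34; rewrite VM // VM // !VX // !V_V // => <-.
by ring.
Qed.

Lemma V_eta_neq0 k : (0 < k)%N -> V k eta != 0.
Proof.
move=> k0; apply: V_neq0 => //.
by apply: fps_mulf_neq0; [exact: mono_neq0 | exact: V_euler_neq0].
Qed.

Lemma theta234_eta : theta2 * theta3 * theta4 = 2%:R * V 2 eta ^+ 3.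
Proof.
apply: (@fps_mulfI (V 2 eta)); first exact: V_eta_neq0.
transitivity (theta2 * V 2 eta * (theta3 * theta4)); first by ring.
rewrite theta2_eta -mulrA [V 4 eta ^+ 2 * _]mulrC theta34_eta; ring.
Qed.

Lemma th_symm k c : (0 < k)%N -> th k (fun x => c (- x)) = th k c.
Proof.
move=> k0; apply: fpsP => n /=; congr (_%:~R).
apply: (sum_bij (h := -%R) (h' := -%R)); try exact: zbox_uniq.
  by move=> x; rewrite !mem_zbox abszN opprK.
by move=> x; rewrite !mem_zbox abszN opprK.
Qed.

Lemma thD k c c' : th k c + th k c' = th k (fun x => c x + c' x).
Proof.
apply: fpsP => n; rewrite fcoefD /= -rmorphD -big_split /=; congr (_%:~R).
by apply: eq_bigr => p _; case: ifP.
Qed.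
Lemma thN k c : - th k c = th k (fun x => - c x).
Proof.
apply: fpsP => n; rewrite fcoefN /= -rmorphN -sumrN; congr (_%:~R).
by apply: eq_bigr => p _; case: ifP; rewrite ?oppr0.
Qed.

(** Euler's pentagonal theorem only reaches the indices [6 s - 1]; the sign
    change of the index gives the other half. *)
Lemma theta_etaE : theta_eta = 2%:R * eta.
Proof.
pose c x := if (x %% 6 == 5)%Z then chi4 x * chi3 x else 0.
have -> : eta = th 1 c.
  rewrite /eta -euler_pentagonal.
  apply: (@exp_series_th _ _ _ _ _ _ 6 (-1) (fun x => ((x + 1) %/ 6)%Z)) =>
    // [s|s|s|s|x].
  - exact: jacobi_exp_bound.
  - have [e _] := @jacobi_expE 3 1 s isT; rewrite PoszD PoszM;
    apply: (@mulfI _ (2 : int)) => //.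
    by rewrite mulrDr mulrCA e; ring.
  - rewrite /c /chi4 /chi3; case: (boolP (odd (absz s))) => h /=;
    do !case: ifP => ? //=; lia.
  - lia.
  - by rewrite /c; case: ifP => //; lia.
rewrite mulr_natl mulr2n -{2}th_symm // thD; apply: eq_th => x.
rewrite /c chi4N chi3N mulrNN /chi4 /chi3.
by do !case: ifP => ? //=; lia.
Qed.

(** With [x = 2 s - 1], Jacobi's identity has coefficient
    [chi4(x) (x + 1) / 2]; the part without [x] vanishes by oddness of the
    character. *)
Lemma theta_eta3E : theta_eta3 = 2%:R * eta ^+ 3.
Proof.
pose c x := chi4 x * ((x + 1) %/ 2)%Z.
have -> : eta ^+ 3 = th 3 c.
  rewrite /eta exprMn monoX -VX // -jacobi_identity.
  apply: (@exp_series_th _ _ _ _ _ _ 2 (-1) (fun x => ((x + 1) %/ 2)%Z)) =>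
    // [s|s|s|s|x].
  - exact: jacobi_exp_bound.
  - have [e _] := @jacobi_expE 1 0 s isT; rewrite PoszD PoszM;
    apply: (@mulfI _ (2 : int)) => //.
    by rewrite mulrDr mulrCA e; ring.
  - rewrite /c; have -> : ((2 * s - 1 + 1) %/ 2)%Z = s by lia.
    congr (_ * _); rewrite /chi4; case: (boolP (odd (absz s))) => h /=;
    do !case: ifP => ? //=; lia.
  - lia.
  - by rewrite /c /chi4; do !case: ifP => ? //=; rewrite ?mul0r ?eqxx //; lia.
have z : th 3 chi4 = 0.
  have e : th 3 chi4 = - th 3 chi4.
    by rewrite -{1}th_symm // thN; apply: eq_th => x; rewrite chi4N.
  have e2 : 2%:R * th 3 chi4 = 0 by rewrite mulr_natl mulr2n {1}e addNr.
  by apply: (fps_mulf_eq0 e2); apply: fps_natf_neq0.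
rewrite mulr_natl mulr2n -[RHS]subr0 -z thN !thD; apply: eq_th => x.
rewrite /c; set w := ((x + 1) %/ 2)%Z.
transitivity (chi4 x * (w + w - 1)); last by ring.
by rewrite /w /chi4; do !case: ifP => ? //=; rewrite ?mul0r //; congr (_ * _); lia.
Qed.

(** * Halphen's differential system *)

(** The equation [D f = L * f] says that [L] is the logarithmic derivative of
    [f]. Logarithmic derivatives are handled in this form because [theta2] and
    [eta] are not invertible as power series. *)
Lemma dlogX f L n : D f = L * f -> D (f ^+ n) = n%:R * L * f ^+ n.
Proof. by case: n => [|n] h; rewrite derX ?mul0r // h /= [f ^+ n.+1]exprS; ring. Qed.
Lemma dlogM f g L M : D f = L * f -> D g = M * g -> D (f * g) = (L + M) * (f * g).
Proof. by move=> hf hg; rewrite derM hf hg; ring. Qed.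
Lemma dlog_div f g L M : g != 0 -> D g = M * g -> D (f * g) = (L + M) * (f * g) ->
  D f = L * f.
Proof.
move=> nz hg; rewrite derM hg => h; apply: (fps_mulfI nz) => /=.
apply: (@addrI _ (M * (f * g))); transitivity (D f * g + f * (M * g)); first by ring.
by rewrite h; ring.
Qed.
Lemma dlog_root f L n : f != 0 -> D (f ^+ n.+1) = n.+1%:R * L * f ^+ n.+1 -> D f = L * f.
Proof.
move=> nz; rewrite derX /= => h.
have nz' : n.+1%:R * f ^+ n != 0 by rewrite fps_mulf_neq0 ?fps_natf_neq0 ?fps_expf_neq0.
by apply: (fps_mulfI nz') => /=; rewrite h exprS; ring.
Qed.
Lemma dlogV k f L : D f = L * f -> (0 < k)%N -> D (V k f) = k%:R * V k L * V k f.
Proof. by move=> h k0; rewrite der_V h VM // mulrA. Qed.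

Lemma th_0 k c : th k c 0%N = (c 0)%:~R.
Proof. by rewrite /= /zbox /= big_seq1 subrr /= muln0. Qed.
Lemma theta2_0 : theta2 0%N = 0. Proof. exact: th_0. Qed.
Lemma theta3_0 : theta3 0%N = 1. Proof. exact: th_0. Qed.
Lemma theta4_0 : theta4 0%N = 1. Proof. exact: th_0. Qed.

Lemma coef0_neq0 (f : fps) : f 0%N = 1 -> f != 0.
Proof. by move=> f0; apply: (@fps_neq0 _ 0); rewrite f0 oner_neq0. Qed.
Lemma theta3_neq0 : theta3 != 0. Proof. exact: coef0_neq0 theta3_0. Qed.
Lemma theta4_neq0 : theta4 != 0. Proof. exact: coef0_neq0 theta4_0. Qed.
Lemma eta_neq0 : eta != 0. Proof. by rewrite -[eta]V1E V_eta_neq0. Qed.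
#[local] Hint Resolve theta3_neq0 theta4_neq0 eta_neq0 : core.

(** Together with [theta2_4] and [dlog4], generates a ring stable under [D];
    these are [X], [Y] and [T] in the explanation above. *)
Definition theta4_4 := theta4 ^+ 4.
Definition theta2_4 := theta2 ^+ 4.
Definition dlog4 := D theta4 * fps_inv theta4.

Lemma der_theta4 : D theta4 = dlog4 * theta4.
Proof. by rewrite /dlog4 -mulrA [fps_inv _ * _]mulrC fps_mulfV ?mulr1 // theta4_0. Qed.

(** The bracket of [theta3] and [theta4], divided by their product, is the
    difference of their logarithmic derivatives; as an eta quotient it equals
    [6 theta2^4]. *)
Lemma der_theta3 : D theta3 = (dlog4 + 6%:R * theta2_4) * theta3.
Proof.
apply: (fps_mulfI theta4_neq0) => /=.
have e : 24%:R * V 4 theta_eta3 ^+ 2 = 6%:R * theta2_4 * theta3 * theta4.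
  rewrite theta_eta3E VM // V_nat VX // /theta2_4.
  transitivity (6%:R * theta2 ^+ 3 * (theta2 * theta3 * theta4)); last by ring.
  transitivity (6%:R * 2%:R * (2%:R * V 4 eta ^+ 2) ^+ 3); first by ring.
  by rewrite theta234_eta -theta2_eta; ring.
have b := bracket34; rewrite e der_theta4 in b.
transitivity (D theta3 * theta4 - theta3 * (dlog4 * theta4) + dlog4 * theta3 * theta4);
  first by ring.
by rewrite b; ring.
Qed.

Lemma der_theta2 : D theta2 = (dlog4 + 6%:R * theta4_4 + 6%:R * theta2_4) * theta2.
Proof.
apply: (fps_mulfI theta3_neq0) => /=.
have e : 3%:R * theta_eta3 ^+ 2 = 6%:R * theta4_4 * theta2 * theta3.
  rewrite theta_eta3E /theta4_4.
  transitivity (6%:R * theta4 ^+ 3 * (theta2 * theta3 * theta4)); last by ring.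
  transitivity (12%:R * (eta ^+ 2) ^+ 3); first by ring.
  by rewrite theta234_eta -theta4_eta; ring.
have b := bracket23; rewrite e der_theta3 in b.
transitivity (D theta2 * theta3 - theta2 * ((dlog4 + 6%:R * theta2_4) * theta3)
   + (dlog4 + 6%:R * theta2_4) * theta2 * theta3); first by ring.
by rewrite b; ring.
Qed.

Lemma der_theta4_4 : D theta4_4 = 4%:R * dlog4 * theta4_4.
Proof. by rewrite /theta4_4 (dlogX 4 der_theta4). Qed.
Lemma der_theta2_4 : D theta2_4 = 4%:R * (dlog4 + 6%:R * theta4_4
  + 6%:R * theta2_4) * theta2_4.
Proof. by rewrite {1}/theta2_4 (dlogX 4 der_theta2). Qed.

(** Both sides have the same logarithmic derivative. *)
Lemma jacobi_quartic : theta3 ^+ 4 = theta4_4 + theta2_4.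
Proof.
apply: (@der_uniq (4%:R * (dlog4 + 6%:R * theta2_4))).
- exact: (dlogX 4 der_theta3).
- by rewrite derD der_theta4_4 der_theta2_4; ring.
- by rewrite fcoefX0 theta3_0 expr1n.
by rewrite fcoefD /theta4_4 /theta2_4 !fcoefX0 theta4_0 theta2_0 expr1n expr0n addr0.
Qed.

Lemma V2theta4 : V 2 theta4 * V 4 eta = V 2 eta ^+ 2.
Proof. by have := congr1 (V 2) theta4_eta; rewrite VM // VX // V_V. Qed.

(** Both sides are the same eta quotient. *)
Lemma landen4 : V 2 theta4 ^+ 2 = theta3 * theta4.
Proof.
have nz : V 4 eta ^+ 2 != 0 by apply: fps_expf_neq0; apply: V_eta_neq0.
apply: (fps_mulfI nz) => /=; rewrite [RHS]mulrC theta34_eta.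
by transitivity ((V 2 theta4 * V 4 eta) ^+ 2); [ring | rewrite V2theta4; ring].
Qed.

Lemma landen23 : 2%:R * V 2 (theta2 * theta3) = theta2 ^+ 2.
Proof.
have nz : V 2 theta4 * V 4 eta != 0.
  by apply: fps_mulf_neq0; [apply: V_neq0 | apply: V_eta_neq0].
apply: (fps_mulfI nz) => /=; rewrite [in RHS]V2theta4.
have e : V 2 (theta2 * theta3) * V 2 theta4 = 2%:R * V 4 eta ^+ 3.
  have := congr1 (V 2) theta234_eta; rewrite VM // [V 2 (2%:R
    * _)]VM // V_nat VX // V_V //.
transitivity (2%:R * (V 2 (theta2 * theta3) * V 2 theta4) * V 4 eta); first by ring.
rewrite e; transitivity ((2%:R * V 4 eta ^+ 2) ^+ 2); first by ring.
by rewrite -theta2_eta; ring.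
Qed.

(** If [f(q) = c f(q^2)], the coefficients of odd degree vanish, the constant
    one because [c] is not 1, and the others by descent. *)
Lemma V2_fix (c : rat) (f : fps) : c != 1 -> f = Fps (fun n => c * V 2 f n) -> f = 0.
Proof.
move=> c1 h; have fE n : f n = c * V 2 f n by rewrite {1}h.
have f0 : f 0%N = 0.
  have /eqP := fE 0%N; rewrite V_0 -{1}[f 0%N]mul1r -subr_eq0 -mulrBl mulf_eq0 subr_eq0
    eq_sym.
  by rewrite (negbTE c1) => /eqP.
apply: fpsP => n; elim/ltn_ind: n => -[|n] IH //.
rewrite fE /=; case: ifP => [/dvdnP[m e]|_]; last by rewrite mulr0.
by rewrite e mulnK // IH ?mulr0 //; lia.
Qed.

Lemma V2_dlog4 : 2%:R * V 2 dlog4 = dlog4 + 3%:R * theta2_4.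
Proof.
have h := dlogX 2 (dlogV der_theta4 (ltn0Sn 1)).
rewrite landen4 (dlogM der_theta3 der_theta4) in h.
have nz : 2%:R * (theta3 * theta4) != 0.
  by apply: fps_mulf_neq0; [apply: fps_natf_neq0 | apply: fps_mulf_neq0].
apply: (fps_mulfI nz) => /=.
transitivity (2%:R * (2%:R * V 2 dlog4) * (theta3 * theta4)); first by ring.
by rewrite -h; ring.
Qed.

(** Differentiating the logarithmic derivative of Landen's identity,
    [2 T(q^2) = T + 3 Y], expresses [(D T)(q^2)] by [D T]. Together with
    [16 (Y (X + Y))(q^2) = Y^2] this shows that the defect [w] of the equation
    satisfies [w(q) = 4 w(q^2)]. *)
Lemma der_dlog4 : D dlog4 = 2%:R * dlog4 ^+ 2 - 72%:R * theta2_4 * (theta4_4 + theta2_4).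
Proof.
pose w := D dlog4 - (2%:R * dlog4 ^+ 2 - 72%:R * theta2_4 * (theta4_4 + theta2_4)).
suff w0 : w = 0 by apply/eqP; rewrite -subr_eq0; apply/eqP.
apply: (@V2_fix 4%:R) => //.
(* the fourth power of [landen23] *)
have YV : 16%:R * V 2 (theta2_4 * (theta4_4 + theta2_4)) = theta2_4 ^+ 2.
  rewrite -jacobi_quartic /theta2_4 -exprMn VX // -[RHS]exprM.
  by rewrite -[(4 * 2)%N]/(2 * 4)%N exprM -landen23; ring.
(* the derivative of [V2_dlog4] *)
have dT : D dlog4 + 12%:R * (dlog4 + 6%:R * theta4_4 + 6%:R * theta2_4) * theta2_4
  = 4%:R * V 2 (D dlog4).
  transitivity (D (dlog4 + 3%:R * theta2_4));
    first by rewrite derD der_natM der_theta2_4; ring.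
  by rewrite -V2_dlog4 der_natM der_V; ring.
have -> : Fps (fun n => 4%:R * V 2 w n) = 4%:R * V 2 w.
  by apply: fpsP => n; rewrite fcoef_natl.
rewrite {2}/w VB mulrBr -dT VB.
have -> : V 2 (2%:R * dlog4 ^+ 2) = 2%:R * V 2 dlog4 ^+ 2 by rewrite VM // V_nat VX.
have -> : V 2 (72%:R * theta2_4 * (theta4_4 + theta2_4))
  = 72%:R * V 2 (theta2_4 * (theta4_4 + theta2_4)).
  by rewrite -mulrA VM // V_nat.
rewrite /w.
transitivity (D dlog4 + 12%:R * (dlog4 + 6%:R * theta4_4 + 6%:R * theta2_4) * theta2_4
  - 2%:R * (2%:R * V 2 dlog4) ^+ 2 + 18%:R * (16%:R * V 2 (theta2_4 * (theta4_4
    + theta2_4)))); last by ring.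
by rewrite YV V2_dlog4; ring.
Qed.

Lemma der_eta2 : D (V 2 eta) = (dlog4 + 2%:R * theta4_4 + 4%:R * theta2_4) * V 2 eta.
Proof.
apply: (@dlog_root _ _ 2); first exact: V_eta_neq0.
have h := dlogM (dlogM der_theta2 der_theta3) der_theta4;
  rewrite theta234_eta der_natM in h.
by apply: (fps_mulfI (fps_natf_neq0 1)) => /=; rewrite h; ring.
Qed.

Lemma der_eta : D eta = (dlog4 + theta4_4 + 2%:R * theta2_4) * eta.
Proof. by apply: (@dlog_root _ _ 1) => //;
  rewrite -theta4_eta (dlogM der_theta4 der_eta2); ring. Qed.

Lemma der_eta4 : D (V 4 eta) = (dlog4 + 4%:R * theta4_4 + 5%:R * theta2_4) * V 4 eta.
Proof.
apply: (@dlog_root _ _ 1); first exact: V_eta_neq0.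
have h := dlogM der_theta2 der_eta2; rewrite theta2_eta der_natM in h.
by apply: (fps_mulfI (fps_natf_neq0 1)) => /=; rewrite h; ring.
Qed.

Lemma theta_uE : theta_u * theta3 = 2%:R * V 2 eta ^+ 4.
Proof.
apply: (fps_mulfI (fps_natf_neq0 1)) => /=;
  rewrite theta_u_theta3 theta_etaE theta_eta3E !V_natM // VX //; ring.
Qed.

Lemma theta_usE : theta_us * theta4 = - (2%:R * V 2 eta ^+ 4).
Proof.
apply: (fps_mulfI (fps_natf_neq0 1)) => /=;
  rewrite theta_us_theta4 theta_etaE theta_eta3E !V_natM // VX //; ring.
Qed.

Lemma V2_theta_vE : V 2 theta_v * V 4 eta = 2%:R * V 2 eta ^+ 3 * V 2 theta4.
Proof.
apply: (fps_mulfI (fps_natf_neq0 1)) => /=.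
have := congr1 (V 2) theta_v_eta2; rewrite theta_etaE theta_eta3E V_natM // VM //
  !V_natM // VM // V_natM // V_V // VX // => e.
by transitivity (V 2 theta_v * (2%:R * V 4 eta)); [ring | rewrite e; ring].
Qed.

Lemma der_theta_u : D theta_u = (3%:R * dlog4 + 8%:R * theta4_4
  + 10%:R * theta2_4) * theta_u.
Proof.
apply: (dlog_div theta3_neq0 der_theta3).
by rewrite theta_uE der_natM (dlogX 4 der_eta2); ring.
Qed.

Lemma der_theta_us : D theta_us = (3%:R * dlog4 + 8%:R * theta4_4
  + 16%:R * theta2_4) * theta_us.
Proof.
apply: (dlog_div theta4_neq0 der_theta4).
by rewrite theta_usE derN der_natM (dlogX 4 der_eta2); ring.
Qed.

Lemma der_V2_theta_v : D (V 2 theta_v)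
  = (3%:R * dlog4 + 2%:R * theta4_4 + 10%:R * theta2_4) * V 2 theta_v.
Proof.
apply: (dlog_div (V_eta_neq0 (isT : 0 < 4)%N) der_eta4).
rewrite V2_theta_vE -mulrA der_natM (dlogM (dlogX 3 der_eta2) (dlogV der_theta4 (ltn0Sn
  1))) V2_dlog4.
by ring.
Qed.

(** The left-hand side is the theta series with harmonic polynomial
    [x^3 - 9 x y^2], up to a constant: a form with complex multiplication by
    Q(sqrt -3). The term in [q^4] appears because Z[sqrt -3] has index 2 in
    the Eisenstein integers. *)
Lemma eta8 : D theta_u * theta3 - 3%:R * (theta_u * D theta3)
  = 16%:R * (eta ^+ 8 - 16%:R * V 4 eta ^+ 8).
Proof.
rewrite der_theta_u der_theta3.
transitivity (8%:R * (theta4_4 - theta2_4) * (theta_u * theta3)); first by ring.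
rewrite theta_uE; transitivity (16%:R * ((theta4 * V 2 eta) ^+ 4 - (theta2
  * V 2 eta) ^+ 4)).
  by rewrite /theta4_4 /theta2_4; ring.
by rewrite theta4_eta theta2_eta; ring.
Qed.

(** Complex multiplication by Q(i), with the harmonic polynomial
    [X Y (X^2 - Y^2)] at [X = 2 x]. *)
Lemma eta10 : D theta_u * V 2 theta_v - theta_u * D (V 2 theta_v) = 24%:R * eta ^+ 10.
Proof.
rewrite der_theta_u der_V2_theta_v; transitivity (6%:R * (theta_u * V 2 theta_v
  * theta4_4)); first by ring.
have nz : V 2 eta ^+ 4 != 0 by apply: fps_expf_neq0; apply: V_eta_neq0.
apply: (fps_mulfI nz) => /=; rewrite -{1}theta34_eta.
transitivity (6%:R * (theta_u * theta3) * (V 2 theta_v * V 4 eta) * (theta4 ^+ 5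
  * V 4 eta)).
  by rewrite /theta4_4; ring.
rewrite theta_uE V2_theta_vE.
transitivity (24%:R * V 2 eta ^+ 7 * theta4 ^+ 5 * (V 2 theta4 * V 4 eta)); first by ring.
rewrite V2theta4; transitivity (24%:R * V 2 eta ^+ 4 * (theta4 * V 2 eta) ^+ 5);
  first by ring.
by rewrite theta4_eta; ring.
Qed.

(** The identity behind [eta14], for arbitrary solutions of Halphen's
    system. *)
Lemma bracket14 (f g t x y : fps) :
  D t = 2%:R * t ^+ 2 - 72%:R * y * (x + y) -> D x = 4%:R * t * x ->
  D y = 4%:R * (t + 6%:R * x + 6%:R * y) * y ->
  D f = (3%:R * t + 8%:R * x + 16%:R * y) * f ->
  D g = (3%:R * t + 6%:R * x + 12%:R * y) * g ->
  6%:R * (D (D f) * g) - 20%:R * (D f * D g) + 6%:R * (f * D (D g))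
    = - 360%:R * (x ^+ 2 * (f * g)).
Proof.
move=> dt dx dy df dg; rewrite dg df !(der_natM, derD, derM) df dg dt dx dy.
by ring.
Qed.

(** Complex multiplication by Q(sqrt -3); the coefficients 6, -20, 6 are those
    of the imaginary part of [(X + i Y)^6]. *)
Lemma eta14 : 6%:R * (D (D theta_us) * V 2 theta_eta3) - 20%:R * (D theta_us
  * D (V 2 theta_eta3)) + 6%:R * (theta_us * D (D (V 2 theta_eta3)))
  = 1440%:R * eta ^+ 14.
Proof.
have J2 : V 2 theta_eta3 = 2%:R * V 2 eta ^+ 3 by rewrite theta_eta3E VM // V_nat VX.
have dJ : D (V 2 theta_eta3) = (3%:R * dlog4 + 6%:R * theta4_4
  + 12%:R * theta2_4) * V 2 theta_eta3.
  by rewrite J2 der_natM (dlogX 3 der_eta2); ring.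
rewrite (bracket14 der_dlog4 der_theta4_4 der_theta2_4 der_theta_us) //.
rewrite J2; apply: (fps_mulfI theta4_neq0) => /=.
transitivity (- 720%:R * (theta4_4 ^+ 2 * V 2 eta ^+ 3 * (theta_us * theta4)));
  first by ring.
rewrite theta_usE; transitivity (1440%:R * theta4 * (theta4 * V 2 eta) ^+ 7).
  by rewrite /theta4_4; ring.
by rewrite theta4_eta; ring.
Qed.

(** * The twenty-sixth power of eta *)

Definition mono3 := (nat * nat * nat)%type.
(** Polynomials in [T], [X], [Y] as lists of monomials, with binary integer
    coefficients, so that the sixth derivatives needed for [eta26] are
    computed instead of rewritten. *)
Definition qpoly := seq (BinNums.Z * mono3).

Fixpoint qadd (m : BinNums.Z * mono3) (p : qpoly) : qpoly :=
  if p is m' :: p' then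
    if m.2 == m'.2 then (BinInt.Z.add m.1 m'.1, m.2) :: p' else m' :: qadd m p'
  else [:: m].
Definition qnorm (p : qpoly) : qpoly := foldr qadd [::] p.

(** The monomial [z T^i X^j Y^k] of a coefficient of [f] is sent to the
    monomials of the coefficient of [D f], where [a T + b X + c Y] is the
    logarithmic derivative of [f]. *)
Definition qder1 (a b c : BinNums.Z) (m : BinNums.Z * mono3) : qpoly :=
  let: (z, (i, j, k)) := m in
  [:: (BinInt.Z.mul z (BinInt.Z.add (BinInt.Z.of_nat (2 * i + 4 * j
    + 4 * k)) a), (i.+1, j, k));
      (BinInt.Z.mul z (BinInt.Z.add (BinInt.Z.of_nat (24 * k)) b), (i, j.+1, k));
      (BinInt.Z.mul z (BinInt.Z.add (BinInt.Z.of_nat (24 * k)) c), (i, j, k.+1));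
      (BinInt.Z.mul z (BinInt.Z.opp (BinInt.Z.of_nat (72 * i))), (i.-1, j.+1, k.+1));
      (BinInt.Z.mul z (BinInt.Z.opp (BinInt.Z.of_nat (72 * i))), (i.-1, j, k.+2))].
Definition qder a b c (p : qpoly) := qnorm (flatten [seq qder1 a b c m | m <- p]).

Definition qmul1 (m n : BinNums.Z * mono3) : BinNums.Z * mono3 :=
  let: (z, (i, j, k)) := m in let: (z', (i', j', k')) := n in
  (BinInt.Z.mul z z', (i + i', j + j', k + k')%N).
Definition qmul (p q : qpoly) : qpoly := [seq qmul1 m n | m <- p, n <- q].
Definition qscale (z : BinNums.Z) (p : qpoly) : qpoly := [seq (BinInt.Z.mul z m.1, m.2)
  | m <- p].

Section Eval.
Variables t x y : fps.

Definition zc (z : BinNums.Z) : fps := (int_of_Z z)%:~R.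
Lemma zcD a b : zc (BinInt.Z.add a b) = zc a + zc b.
Proof. by rewrite /zc -intrD -rmorphD. Qed.
Lemma zcM a b : zc (BinInt.Z.mul a b) = zc a * zc b.
Proof. by rewrite /zc -intrM -rmorphM. Qed.
Lemma zcN a : zc (BinInt.Z.opp a) = - zc a.
Proof. by rewrite /zc -mulrNz -rmorphN. Qed.
Lemma zc_nat n : zc (BinInt.Z.of_nat n) = n%:R.
Proof. by rewrite /zc -[n%:R]/(n%:Z%:~R); congr (_%:~R); case: n => //= n;
  rewrite Pnat.SuccNat2Pos.id_succ. Qed.

Definition evm (m : BinNums.Z * mono3) : fps :=
  zc m.1 * (t ^+ m.2.1.1 * x ^+ m.2.1.2 * y ^+ m.2.2).
Definition ev (p : qpoly) : fps := \sum_(m <- p) evm m.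

Lemma ev_cat p q : ev (p ++ q) = ev p + ev q.
Proof. by rewrite /ev big_cat. Qed.
Lemma ev_add m p : ev (qadd m p) = evm m + ev p.
Proof.
elim: p => [|m' p IH] /=; first by rewrite /ev !big_cons.
case: eqP => [e|_]; last by rewrite /ev !big_cons -/(ev _) IH addrCA.
by rewrite /ev !big_cons addrA; congr (_ + _); rewrite /evm -e zcD mulrDl.
Qed.
Lemma ev_norm p : ev (qnorm p) = ev p.
Proof. by elim: p => //= m p IH; rewrite ev_add IH [RHS]big_cons. Qed.
Lemma ev_flatten (pp : seq qpoly) : ev (flatten pp) = \sum_(p <- pp) ev p.
Proof. by elim: pp => [|p pp IH]; rewrite /= ?big_nil ?ev_cat ?big_cons ?IH // /ev
  big_nil. Qed.
Lemma ev_mul p q : ev (qmul p q) = ev p * ev q.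
Proof.
rewrite /qmul /ev big_allpairs_dep big_distrlr /=.
apply: eq_bigr => -[z [[i j] k]] _; apply: eq_bigr => -[z' [[i' j'] k']] _.
by rewrite /evm /= zcM !exprD; ring.
Qed.
Lemma ev_scale z p : ev (qscale z p) = zc z * ev p.
Proof.
rewrite /ev big_map mulr_sumr; apply: eq_bigr => m _.
by rewrite /evm /= zcM -mulrA.
Qed.
Lemma ev_zero p : all (fun m => BinInt.Z.eqb m.1 BinNums.Z0) p -> ev p = 0.
Proof.
move=> h; rewrite /ev big_seq big1 // => m /(allP h) /BinInt.Z.eqb_eq e.
by rewrite /evm e /zc mul0r.
Qed.

Definition halphen :=
  [/\ D t = 2%:R * t ^+ 2 - 72%:R * y * (x + y), D x = 4%:R * t * x
    & D y = 4%:R * (t + 6%:R * x + 6%:R * y) * y].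

Lemma ev_der f a b c p : halphen -> D f = (zc a * t + zc b * x + zc c * y) * f ->
  D (ev p * f) = ev (qder a b c p) * f.
Proof.
move=> [dt dx dy] df; rewrite /qder ev_norm ev_flatten big_map /ev mulr_suml der_sum
  [RHS]mulr_suml.
apply: eq_bigr => -[z [[i j] k]] _.
rewrite !big_cons big_nil /evm /= !zcM !zcD !zcN !zc_nat.
have dz : D (zc z) = 0 by rewrite /zc der_int.
rewrite 4!derM dz df !derX dt dx dy.
case: i => [|i]; case: j => [|j]; case: k => [|k] /=; rewrite ?exprS; try ring.
Qed.

Definition qders (L : BinNums.Z * BinNums.Z * BinNums.Z) n : qpoly :=
  iter n (qder L.1.1 L.1.2 L.2) [:: (BinInt.Z.of_nat 1, (0, 0, 0))%N].

Definition evL (L : BinNums.Z * BinNums.Z * BinNums.Z) : fps :=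
  zc L.1.1 * t + zc L.1.2 * x + zc L.2 * y.

Lemma ev_ders f L n : halphen -> D f = evL L * f -> iter n D f = ev (qders L n) * f.
Proof.
move=> hl df; elim: n => [|n IH].
  by rewrite /ev big_seq1 /evm (zc_nat 1) /= !expr0 !mul1r.
by rewrite iterS IH; apply: ev_der.
Qed.

(** The bilinear operator with the coefficients of the real part of
    [(X + i Y)^12]: on two theta series it produces the double series with
    this harmonic polynomial. *)
Definition bracket12 (f g : fps) : fps :=
  \sum_(j <- iota 0 7) (-1) ^+ j * 'C(12, 2 * j)%:R * (iter (6 - j) D f * iter j D g).

Definition qbracket12 L M : qpoly :=
  flatten [seq qscale (BinInt.Z.mul (iter j BinInt.Z.opp (BinInt.Z.of_nat 1))
    (BinInt.Z.of_nat 'C(12, 2 * j)))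
     (qmul (qders L (6 - j)) (qders M j)) | j <- iota 0 7].

Lemma ev_bracket12 f g L M : halphen -> D f = evL L * f -> D g = evL M * g ->
  bracket12 f g = ev (qbracket12 L M) * (f * g).
Proof.
move=> hl df dg; rewrite /qbracket12 ev_flatten big_map mulr_suml; apply: eq_bigr => j _.
rewrite ev_scale ev_mul (ev_ders _ hl df) (ev_ders _ hl dg) zcM zc_nat.
have -> : zc (iter j BinInt.Z.opp (BinInt.Z.of_nat 1)) = (-1) ^+ j.
  elim: j => [|j IH]; first exact: (zc_nat 1).
  by rewrite iterS zcN IH exprS mulN1r.
by ring.
Qed.

(** The two brackets are theta series for Q(i) and for Q(sqrt -3). As
    polynomials in [T], [X], [Y] all their terms but one are opposite. *)
Lemma qbracket12_eval f g : halphen ->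
  D f = (t + x + 2%:R * y) * f -> D g = (t + 2%:R * x + 4%:R * y) * g ->
  forall h, D h = t * h -> g * h = f ^+ 2 ->
  bracket12 f f + bracket12 g h
  = (512 * 81 * 121 * 13) * (x ^+ 4 * y * (x + y) * f ^+ 2).
Proof.
move=> hl df dg h dh gh.
pose z n := BinInt.Z.of_nat n.
rewrite (@ev_bracket12 f f (z 1, z 1, z 2) (z 1, z 1, z 2)) //; last 2 first.
- by rewrite df /evL !zc_nat; ring.
- by rewrite df /evL !zc_nat; ring.
rewrite (@ev_bracket12 g h (z 1, z 2, z 4) (z 1, z 0, z 0)) //; last 2 first.
- by rewrite dg /evL !zc_nat; ring.
- by rewrite dh /evL !zc_nat; ring.
rewrite gh -expr2 -mulrDl -ev_cat mulrA; congr (_ * _).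
(* what survives in the sum of the two brackets: [C X^4 Y (X + Y)] *)
pose C : BinNums.Z := BinInt.Z.mul (BinInt.Z.mul (BinInt.Z.mul (z 512) (z 81)) (z 121))
  (z 13).
have e : ev [:: (C, (0, 5, 1)); (C, (0, 4, 2))]%N
  = (512 * 81 * 121 * 13) * (x ^+ 4 * y * (x + y)).
  by rewrite /ev !big_cons big_nil /evm /= !zcM !zc_nat; ring.
rewrite -e; apply/eqP; rewrite -subr_eq0; apply/eqP.
set P := ev (_ ++ _); set Q := ev _.
have -> : P - Q = P + zc (BinInt.Z.opp (z 1)) * Q by rewrite zcN zc_nat mulN1r.
rewrite -ev_scale -ev_cat -ev_norm; apply: ev_zero.
by vm_compute.
Qed.

End Eval.

Lemma eta26 : bracket12 eta eta + bracket12 (V 2 eta) theta4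
  = (512 * 81 * 121 * 13 * 16) * eta ^+ 26.
Proof.
have hl : halphen dlog4 theta4_4 theta2_4 by split;
  [exact: der_dlog4 | exact: der_theta4_4 | exact: der_theta2_4].
rewrite (qbracket12_eval hl der_eta der_eta2 der_theta4) ?[_
  * theta4]mulrC ?theta4_eta //.
have -> : theta4_4 ^+ 4 * theta2_4 * (theta4_4 + theta2_4) * eta ^+ 2
  = 16%:R * eta ^+ 26; last by ring.
rewrite -jacobi_quartic.
transitivity (theta4 ^+ 12 * (theta2 * theta3 * theta4) ^+ 4 * eta ^+ 2).
  by rewrite /theta4_4 /theta2_4; ring.
rewrite theta234_eta; transitivity (16%:R * (theta4 * V 2 eta) ^+ 12 * eta ^+ 2);
  first by ring.
by rewrite theta4_eta; ring.
Qed.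

(** * Divisibility of coefficients at inert primes *)

(** The rational [x] is [l]-integral and divisible by [l^m]. *)
Definition ldvd (l m : nat) (x : rat) : Prop :=
  exists (a : int) (b : nat), ~~ (l %| b)%N /\ b%:R * x = (l ^ m)%:R * a%:~R.

Section Ldvd.
Variable l : nat.
Hypothesis pl : prime l.
Lemma ldvd0 m : ldvd l m 0.
Proof. by exists 0, 1%N; rewrite dvdn1 gtn_eqF ?prime_gt1 // !mulr0. Qed.
Lemma ldvdD m x y : ldvd l m x -> ldvd l m y -> ldvd l m (x + y).
Proof.
move=> [a [b [hb e]]] [a' [b' [hb' e']]]; exists (a * b'%:Z + a' * b%:Z), (b * b')%N.
rewrite Euclid_dvdM // (negbTE hb) (negbTE hb'); split=> //.
rewrite natrM intrD !intrM -![_%:Z%:~R]/(_%:R).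
transitivity (b'%:R * (b%:R * x) + b%:R * (b'%:R * y)); first by ring.
by rewrite e e'; ring.
Qed.
Lemma ldvdM m n x y : ldvd l m x -> ldvd l n y -> ldvd l (m + n) (x * y).
Proof.
move=> [a [b [hb e]]] [a' [b' [hb' e']]]; exists (a * a'), (b * b')%N.
rewrite Euclid_dvdM // (negbTE hb) (negbTE hb'); split=> //.
by rewrite natrM intrM expnD natrM mulrACA e e'; ring.
Qed.
Lemma ldvd_int (a : int) : ldvd l 0 a%:~R.
Proof. by exists a, 1%N; rewrite dvdn1 gtn_eqF ?prime_gt1 // !mul1r. Qed.
Lemma ldvd_intM m (a : int) : (l%:Z ^+ m %| a)%Z -> ldvd l m a%:~R.
Proof.
move=> /dvdzP[q ->]; exists q, 1%N; rewrite dvdn1 gtn_eqF ?prime_gt1 //; split=> //.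
by rewrite mul1r intrM mulrC rmorphXn natrX.
Qed.
Lemma ldvd_sum m I (r : seq I) (P : pred I) (F : I -> rat) :
  (forall i, P i -> ldvd l m (F i)) -> ldvd l m (\sum_(i <- r | P i) F i).
Proof. by move=> h; apply: (big_ind (ldvd l m)) => //; [apply: ldvd0 | move=> x y;
  apply: ldvdD]. Qed.
Lemma ldvd_cancel m (c : nat) x : ~~ (l %| c)%N -> ldvd l m (c%:R * x) -> ldvd l m x.
Proof.
move=> hc [a [b [hb e]]]; exists a, (b * c)%N;
  rewrite Euclid_dvdM // (negbTE hb) (negbTE hc).
by split=> //; rewrite natrM -mulrA.
Qed.

(** The shape of the coefficients of a form of positive degree with complex
    multiplication in which [l] is inert: an index divisible by [l] comes only
    from multiples of [l] in the ring of integers, which have norm divisible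
    by [l^2]. *)
Definition inert (f : fps) := forall N, (l %| N)%N ->
  (~~ (l ^ 2 %| N)%N -> f N = 0) /\ ldvd l 1 (f N).

Lemma inertD f g : inert f -> inert g -> inert (f + g).
Proof.
move=> hf hg N lN; have [f0 fd] := hf N lN; have [g0 gd] := hg N lN.
by split=> [h|]; rewrite fcoefD; [rewrite f0 ?g0 ?addr0 | apply: ldvdD].
Qed.
Lemma inert_zM (c : int) f : inert f -> inert (c%:~R * f).
Proof.
move=> hf N lN; have [f0 fd] := hf N lN; rewrite mulrzl fcoefMz -mulrzl.
by split=> [h|]; [rewrite f0 ?mulr0 | rewrite -[1%N]add0n; apply: ldvdM => //;
  apply: ldvd_int].
Qed.
Lemma inertN f : inert f -> inert (- f).
Proof. by move=> /(inert_zM (-1)); rewrite mulN1r. Qed.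
Lemma inert_nM (c : nat) f : inert f -> inert (c%:R * f).
Proof. exact: (inert_zM c). Qed.
Lemma inert_cancel (c : nat) f : ~~ (l %| c)%N -> inert (c%:R * f) -> inert f.
Proof.
move=> hc hf N lN; have [f0 fd] := hf N lN; rewrite fcoef_natl in f0 fd.
split; last exact: ldvd_cancel hc fd.
move=> /f0 /eqP; rewrite mulf_eq0 pnatr_eq0 => /orP[/eqP c0|/eqP //].
by rewrite c0 dvdn0 in hc.
Qed.

(** Descent on the index: [f(q^4)] contributes the coefficient of index
    [N / 4], which is divisible by the same powers of the odd prime [l]. *)
Lemma inert_V4 (c : nat) (f s : fps) : odd l -> f 0%N = 0 -> inert s ->
  f = s + c%:R * V 4 f -> inert f.
Proof.
move=> ol f0 hs fE; elim/ltn_ind => -[|N] IH lN; first by rewrite f0; split=> //;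
  apply: ldvd0.
have [s0 sd] := hs _ lN; rewrite fE fcoefD fcoef_natl /=.
case: ifP => [/dvdnP[M e]|_]; last by rewrite mulr0 addr0.
have cop k : coprime (l ^ k) 4 by apply: coprimeXl; apply: (@coprimeXr 2 l 2);
  rewrite coprimen2.
rewrite e mulnK //; have lM : (l %| M)%N by rewrite e Gauss_dvdl // in lN;
  exact: (cop 1%N).
have [|M0 Md] := IH M _ lM; first by lia.
rewrite e in s0 sd *; split=> [h|].
  rewrite s0 // add0r M0 ?mulr0 //; apply: contra h; rewrite Gauss_dvdl //; exact: cop.
by apply: ldvdD => //; rewrite -[1%N]add0n; apply: ldvdM => //; apply: (ldvd_int c).
Qed.

Definition aniso k k' := forall x y : int, (l%:Z %| k%:Z * x ^+ 2 + k'%:Z * y ^+ 2)%Z ->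
  (l%:Z %| x)%Z /\ (l%:Z %| y)%Z.

Lemma inert_thM k k' c c' : (0 < k)%N -> (0 < k')%N -> aniso k k' ->
  (forall x y, (l%:Z %| x)%Z -> (l%:Z %| y)%Z -> (l%:Z %| c x * c' y)%Z) ->
  inert (th k c * th k' c').
Proof.
move=> k0 k'0 an hc N lN; rewrite thM // th2E.
have key x y : (k * absz x ^ 2 + k' * absz y ^ 2 == N)%N ->
  (l%:Z %| x)%Z /\ (l%:Z %| y)%Z.
  move=> /eqP e; apply: an; rewrite -!sqr_absz -!PoszM -PoszD e; exact: lN.
split=> [h|]; last first.
  apply: ldvd_intM; rewrite expr1; apply: rpred_sum => x _; apply: rpred_sum => y _.
  by case: ifP => [/key[lx ly]|_]; [apply: hc | apply: dvdz0].
rewrite big1 // => x _; rewrite big1 // => y _; case: ifP => // e.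
have [lx ly] := key _ _ e; case/negP: h; rewrite -(eqP e) dvdn_add // dvdn_mull //.
  exact: dvdn_exp2r.
exact: dvdn_exp2r.
Qed.

End Ldvd.

(** * Anisotropic binary forms modulo a prime *)

Lemma Fp_nat0 l n : prime l -> ((n%:R : 'F_l) == 0) = (l %| n)%N.
Proof. by move=> pl; rewrite -(dvdn_pcharf (pchar_Fp pl)). Qed.

Lemma Fp_fermat l (x : 'F_l) : prime l -> x ^+ l = x.
Proof. by move=> pl; have := expf_card x; rewrite card_Fp. Qed.

(** Raising [x^2 = - y^2] to the odd power [(l - 1) / 2] gives [1 = -1] by
    Fermat. *)
Lemma Fp_sum2 l (x y : 'F_l) : prime l -> (l %% 4 = 3)%N -> x ^+ 2 + y ^+ 2 = 0 -> y = 0.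
Proof.
move=> pl l4 e; apply/eqP; apply/negPn/negP => y0.
have x2 : x ^+ 2 = - y ^+ 2 by apply/eqP; rewrite -addr_eq0 e.
have fermat (z : 'F_l) : z != 0 -> z ^+ 2 ^+ (l %/ 4).*2.+1 = 1.
  move=> z0; apply: (mulfI z0); rewrite -exprM -exprS mulr1 -[RHS](Fp_fermat z pl).
  by congr (_ ^+ _); lia.
have x0 : x != 0.
  by apply: contraNneq y0 => xz; rewrite xz expr0n add0r in e; rewrite -sqrf_eq0 e.
have := fermat x x0; rewrite x2 exprNn fermat // mulr1 -signr_odd /= odd_double /=
  expr1 => /eqP.
rewrite eq_sym -subr_eq0 opprK -[1 + 1]/(2%:R) Fp_nat0 // => /dvdn_leq; lia.
Qed.

(** From [x^2 = - 3 y^2] one gets a primitive cube root of unity in the field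
    with [l] elements; but cubing is injective there, as 3 does not divide
    [l - 1]. *)
Lemma Fp_sum3 l (x y : 'F_l) : prime l -> (l %% 3 = 2)%N -> l <> 2%N ->
  x ^+ 2 + 3%:R * y ^+ 2 = 0 -> y = 0.
Proof.
move=> pl l3 l2 e; apply/eqP; apply/negPn/negP => y0.
have l5 : (4 < l)%N by have := prime_gt1 pl; case: (l) l3 l2 pl => [|[|[|[|[|n]]]]].
have nz2 : 2%:R != 0 :> 'F_l by rewrite Fp_nat0 // gtnNdvd //; lia.
(* [x / y] is a square root of -3, so [w] is a cube root of unity *)
pose w : 'F_l := (x / y - 1) / 2%:R.
have w2 : w ^+ 2 + w + 1 = 0.
  have -> : w ^+ 2 + w + 1 = (x ^+ 2 + 3%:R * y ^+ 2) / (2%:R * y) ^+ 2.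
    by rewrite /w; field; rewrite nz2 y0.
  by rewrite e mul0r.
have w3 : w ^+ 3 = 1.
  have e3 : w ^+ 3 - 1 = (w ^+ 2 + w + 1) * (w - 1) by ring.
  by apply/eqP; rewrite -subr_eq0 e3 w2 mul0r.
have w0 : w != 0 by apply: contraNneq (oner_neq0 'F_l) => wz; rewrite -w3 wz expr0n.
have w1 : w = 1.
  apply: (mulfI w0); rewrite mulr1 -[RHS](Fp_fermat w pl).
  have -> : w * w = w ^+ (3 * (l %/ 3) + 2) by rewrite exprD exprM w3 expr1n mul1r expr2.
  by congr (_ ^+ _); lia.
have e3 : 3%:R = 1 + 1 + 1 :> 'F_l by ring.
by move/eqP: w2; rewrite w1 expr1n -e3 Fp_nat0 // => /dvdn_leq; lia.
Qed.

Lemma aniso1 l : prime l -> (l %% 4 = 3)%N -> aniso l 1 1.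
Proof.
move=> pl l4 x y; rewrite !mul1r -!sqr_absz -PoszD !dvdzE /= -!Fp_nat0 // natrD !natrX
  => /eqP e.
split; apply/eqP; last exact: Fp_sum2 pl l4 e.
by rewrite addrC in e; apply: Fp_sum2 pl l4 e.
Qed.

Lemma aniso3 l : prime l -> (l %% 3 = 2)%N -> l <> 2%N -> aniso l 1 3.
Proof.
move=> pl l3 l2 x y; rewrite mul1r -!sqr_absz -PoszM -PoszD !dvdzE /= -!Fp_nat0 //
  natrD natrM !natrX => /eqP e.
have y0 := Fp_sum3 pl l3 l2 e; split; apply/eqP => //.
by move: e; rewrite y0 expr0n mulr0 addr0 => /eqP; rewrite sqrf_eq0 => /eqP.
Qed.

(** After multiplication by [k] the form becomes [(k x)^2 + c (s y)^2]. *)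
Lemma aniso_form l c k k' s : prime l -> aniso l 1 c -> ~~ (l %| k * s)%N ->
  (k * k' = c * s ^ 2)%N -> aniso l k k'.
Proof.
move=> pl an; rewrite Euclid_dvdM // negb_or => /andP[lk ls] e x y h.
have [hx hy] : (l%:Z %| k%:Z * x)%Z /\ (l%:Z %| s%:Z * y)%Z.
  apply: an; have -> : 1%:Z * (k%:Z * x) ^+ 2 + c%:Z * (s%:Z * y) ^+ 2
      = k%:Z * (k%:Z * x ^+ 2 + k'%:Z * y ^+ 2).
    have e' : k%:Z * k'%:Z = c%:Z * s%:Z ^+ 2 by rewrite -(sqr_absz s) -!PoszM e.
    transitivity (k%:Z ^+ 2 * x ^+ 2 + (c%:Z * s%:Z ^+ 2) * y ^+ 2); first by ring.
    by rewrite -e'; ring.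
  exact: dvdz_mull.
move: hx hy; rewrite !dvdzE !abszM !Euclid_dvdM //= (negbTE lk) (negbTE ls) /=.
by [].
Qed.

(** Coefficients of the [n]-th derivative of [th k c]. *)
Definition fwd k n (c : int -> int) (x : int) : int := (k%:Z * x ^+ 2) ^+ n * c x.
Lemma iter_der_th k c n : iter n D (th k c) = th k (fwd k n c).
Proof.
elim: n => [|n IH]; first by apply: eq_th => x; rewrite /fwd expr0 mul1r.
by rewrite iterS IH der_th; apply: eq_th => x; rewrite /fwd [_ ^+ n.+1]exprS mulrA.
Qed.

(** * The six powers of eta at inert primes *)

Lemma ndvd_small l n : prime l -> (0 < n)%N -> all (fun p =>
  p < l)%N (primes n) -> ~~ (l %| n)%N.
Proof.
move=> pl n0 /allP h; apply/negP => ln.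
by have := h l; rewrite mem_primes pl n0 ln ltnn => /(_ isT).
Qed.

Lemma inert_iter l k k' c c' i j : prime l -> (0 < k)%N -> (0 < k')%N -> aniso l k k' ->
  (0 < i + j)%N -> inert l (iter i D (th k c) * iter j D (th k' c')).
Proof.
move=> pl k0 k'0 an ij; rewrite !iter_der_th; apply: inert_thM => // x y lx ly.
have fw K n e z : (l%:Z %| z)%Z -> (l%:Z %| fwd K n.+1 e z)%Z.
  by move=> h; rewrite /fwd exprS; apply/dvdz_mulr/dvdz_mulr/dvdz_mull; rewrite expr2;
    apply: dvdz_mulr.
by case: i j ij => [|i] [|j] // _; [apply: dvdz_mull | apply: dvdz_mulr | apply:
  dvdz_mulr]; apply: fw.
Qed.

Lemma iter_der_natM n k f : iter n D (k%:R * f) = k%:R * iter n D f.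
Proof. by elim: n => //= n ->; rewrite der_natM. Qed.

Lemma inert_bracket12 l k k' c c' : prime l -> (0 < k)%N -> (0 < k')%N -> aniso l k k' ->
  inert l (bracket12 (th k c) (th k' c')).
Proof.
move=> pl k0 k'0 an; rewrite /bracket12 !big_cons big_nil addr0.
have t (a : int) (b : nat) i j : (0 < i + j)%N ->
    inert l (a%:~R * b%:R * (iter i D (th k c) * iter j D (th k' c'))).
  move=> ij; rewrite -mulrA; apply: inert_zM => //; apply: inert_nM => //;
    exact: inert_iter.
have s j : (-1) ^+ j = ((-1) ^+ j)%:~R :> fps by rewrite rmorphXn rmorphN1.
by rewrite !s; do 6!(apply: inertD => //; first exact: t); exact: t.
Qed.

(** The six cases are the six differential identities. The constants that have
    to be cancelled are prime to [l], which is where 5 is excluded for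
    [d = 14] and 11 for [d = 26]. *)
Lemma inert_eta d l : d \in [:: 4; 6; 8; 10; 14;
  26]%N -> satisfactory d l -> inert l (eta ^+ d).
Proof.
move=> hd /andP[pl sat].
have ol : (2 < l)%N -> odd l by move=> l2; case: (even_prime pl) => // e; rewrite e in l2.
have nd n : (0 < n)%N -> all (fun p =>
  p < l)%N (primes n) -> ~~ (l %| n)%N by exact: ndvd_small.
have H2 : V 2 theta_eta = th 2 (fun x => chi4 x * chi3 x) by rewrite V_th.
have J2 : V 2 theta_eta3 = th 6 (fun x => chi4 x * x) by rewrite V_th.
move: hd; rewrite !inE => /orP[|/orP[|/orP[|/orP[|/orP[]]]]] /eqP e;
  rewrite e /= in sat *.
- have l5 : (4 < l)%N by have := prime_gt1 pl; lia.
  apply: (@inert_cancel l pl 4); first by apply: nd => //=; lia.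
  have -> : 4%:R * eta ^+ 4 = theta_eta * theta_eta3 by rewrite theta_etaE theta_eta3E;
    ring.
  apply: inert_thM => //; first by apply: aniso3; lia.
  by move=> x y _ ly; rewrite mulrA; apply: dvdz_mull.
- have l5 : (4 < l)%N by lia.
  apply: (@inert_cancel l pl 4); first by apply: nd => //=; lia.
  have -> : 4%:R * eta ^+ 6 = theta_eta3 * theta_eta3 by rewrite theta_eta3E; ring.
  apply: inert_thM => //; last by move=> x y _ ly; rewrite mulrA; apply: dvdz_mull.
  apply: (@aniso_form l 1 3 3 3 pl); [by apply: aniso1; lia | by apply: nd => //=;
    lia | by []].
- have l5 : (4 < l)%N by have := prime_gt1 pl; lia.
  have an : aniso l 8 24.
    by apply: (@aniso_form l 3 8 24 8 pl); [apply: aniso3; lia | apply: nd => //=;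
      lia | ].
  apply: (@inert_V4 l pl 16 _ (eta ^+ 8 - 16%:R * V 4 (eta ^+ 8))).
  + by apply: ol; lia.
  + by rewrite fcoefX0 fcoef_monoM.
  + apply: (@inert_cancel l pl 16); first by apply: nd => //=; lia.
    rewrite VX // -eta8; apply: inertD => //; first exact: (@inert_iter l 8 24 _ _ 1 0).
    by apply: inertN => //; apply: inert_nM => //; exact: (@inert_iter l 8 24 _ _ 0 1).
  by rewrite subrK.
- have l5 : (4 < l)%N by lia.
  have an : aniso l 8 2.
    by apply: (@aniso_form l 1 8 2 4 pl); [apply: aniso1; lia | apply: nd => //=; lia | ].
  apply: (@inert_cancel l pl 24); first by apply: nd => //=; lia.
  have W2 : V 2 theta_v = th 2 (fun x => oddz x * chi3 x * x) by rewrite V_th.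
  rewrite -eta10 W2; apply: inertD => //; first exact: (@inert_iter l 8 2 _ _ 1 0).
  by apply: inertN => //; exact: (@inert_iter l 8 2 _ _ 0 1).
- have l5 : (5 < l)%N by have := prime_gt1 pl; lia.
  have an : aniso l 8 6.
    by apply: (@aniso_form l 3 8 6 4 pl); [apply: aniso3; lia | apply: nd => //=; lia | ].
  apply: (@inert_cancel l pl 1440); first by apply: nd => //;
    rewrite (_ : primes 1440 = [:: 2; 3; 5])%N //=; lia.
  rewrite -eta14 J2; apply: inertD => //; first apply: inertD => //.
  + by apply: inert_nM => //; exact: (@inert_iter l 8 6 _ _ 2 0).
  + by apply: inertN => //; apply: inert_nM => //; exact: (@inert_iter l 8 6 _ _ 1 1).
  by apply: inert_nM => //; exact: (@inert_iter l 8 6 _ _ 0 2).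
have l5 : (13 < l)%N by have := prime_gt1 pl; lia.
have an1 : aniso l 1 1 by apply: aniso1; lia.
have an2 : aniso l 2 24.
  by apply: (@aniso_form l 3 2 24 4 pl); [apply: aniso3; lia | apply: nd => //=; lia | ].
have cancel n f : (0 < n)%N -> all (fun p =>
  p < l)%N (primes n) -> inert l (n%:R * f) -> inert l f.
  by move=> n0 h; apply: inert_cancel => //; apply: nd.
have b1 : inert l (4%:R * bracket12 eta eta).
  have -> : 4%:R * bracket12 eta eta = bracket12 theta_eta theta_eta.
    rewrite /bracket12 mulr_sumr; apply: eq_bigr => j _.
    by rewrite theta_etaE !iter_der_natM; ring.
  exact: inert_bracket12.
have b2 : inert l (2%:R * bracket12 (V 2 eta) theta4).
  have -> : 2%:R * bracket12 (V 2 eta) theta4 = bracket12 (V 2 theta_eta) theta4.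
    rewrite /bracket12 mulr_sumr; apply: eq_bigr => j _.
    by rewrite theta_etaE V_natM // !iter_der_natM; ring.
  by rewrite H2; apply: inert_bracket12.
have b : inert l (bracket12 eta eta + bracket12 (V 2 eta) theta4).
  by apply: inertD => //; [apply: cancel b1 | apply: cancel b2] => //=; lia.
have small n s : primes n = s -> all (fun p => p < 14)%N s -> all (fun p =>
  p < l)%N (primes n).
  by move=> -> /allP h; apply/allP => p /h; lia.
move: b; rewrite eta26 -!mulrA.
move=> /(cancel 512%N _ isT (@small 512%N [:: 2]%N erefl isT)).
move=> /(cancel 81%N _ isT (@small 81%N [:: 3]%N erefl isT)).
move=> /(cancel 121%N _ isT (@small 121%N [:: 11]%N erefl isT)).
move=> /(cancel 13%N _ isT (@small 13%N [:: 13]%N erefl isT)).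
by move=> /(cancel 16%N _ isT (@small 16%N [:: 2]%N erefl isT)).
Qed.

(** * Rational powers of the Euler product *)

Section Integrality.
Variable l : nat.
Hypothesis pl : prime l.

Definition lint (f : fps) := forall n, ldvd l 0 (f n).

Lemma lintM f g : lint f -> lint g -> lint (f * g).
Proof.
move=> hf hg n; rewrite fcoefM; apply: ldvd_sum => // i _.
exact: (@ldvdM l pl 0 0).
Qed.
Lemma lint1 : lint 1.
Proof. by move=> n; rewrite fcoef1; apply: (@ldvd_int l pl (n == 0%N)%:Z). Qed.
Lemma lintX f n : lint f -> lint (f ^+ n).
Proof.
by move=> hf; elim: n => [|n IH]; [apply: lint1 | rewrite exprS; apply: lintM].
Qed.
Lemma lintB f g : lint f -> lint g -> lint (f - g).
Proof.
move=> hf hg n; rewrite fcoefB; apply: ldvdD => //; rewrite -mulN1r.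
exact: (@ldvdM l pl 0 0 _ _ (@ldvd_int l pl (-1)) (hg n)).
Qed.
Lemma lint_inv f : lint f -> lint (fps_inv f).
Proof.
move=> hf n; apply: ldvd_sum => // k _; apply: lintX; apply: lintB => //; exact: lint1.
Qed.
Lemma lint_der f : lint f -> lint (D f).
Proof. by move=> hf n; apply: (@ldvdM l pl 0 0 _ _ (@ldvd_int l pl n%:Z) (hf n)). Qed.

Lemma lint_euler : lint euler.
Proof.
move=> n; rewrite /= /qpoch.
have -> : \prod_(1 <= k < n.+1) (1 - 'X^k)
  = map_poly intr (\prod_(1 <= k < n.+1) (1 - 'X^k)) :> {poly rat}.
  by rewrite rmorph_prod; apply: eq_bigr => k _; rewrite rmorphB /= rmorph1 map_polyXn.
by rewrite coef_map; apply: ldvd_int.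
Qed.

(** The top coefficient enters a power [f^b] linearly, with factor [b]. *)
Lemma coefX_diff (f g : fps) n b : (0 < n)%N -> f 0%N = 1 -> g 0%N = 1 -> eqm n f g ->
  (f ^+ b) n - (g ^+ b) n = b%:R * (f n - g n).
Proof.
move=> n0 f0 g0 fg; elim: b => [|b IH]; first by rewrite subrr mul0r.
have fgb := eqmX b fg; case: n n0 fg fgb IH => // n _ fg fgb IH.
have split2 (u v : fps) : (u * v) n.+1
    = u 0%N * v n.+1 + u n.+1 * v 0%N + \sum_(i < n) u i.+1 * v (n - i)%N.
  rewrite fcoefM big_ord_recl big_ord_recr /= subn0 /bump /= add1n subnn.
  by rewrite [X in _ + X]addrC addrA.
rewrite !exprS !split2 !fcoefX0 f0 g0 !expr1n.
have -> : \sum_(i < n) f i.+1 * (f ^+ b) (n - i)%N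
  = \sum_(i < n) g i.+1 * (g ^+ b) (n - i)%N.
  by apply: eq_bigr => i _; rewrite fg ?fgb // ltnS ?ltn_ord ?leq_subr.
transitivity (((f ^+ b) n.+1 - (g ^+ b) n.+1) + (f n.+1 - g n.+1)); first by ring.
by rewrite IH -[b.+1]addn1 natrD; ring.
Qed.

(** By induction on the degree: replacing the coefficient of degree [n] by
    zero changes that of [f^b] by [b f_n], and [b] is a unit at [l]. *)
Lemma lint_root (f : fps) b : ~~ (l %| b)%N -> f 0%N = 1 -> lint (f ^+ b) -> lint f.
Proof.
move=> lb f0 hb; elim/ltn_ind => -[|n] IH; first by rewrite f0; apply: (@ldvd_int l pl 1).
pose g := Fps (fun i => if (i < n.+1)%N then f i else 0).
have hg : lint g.
  by move=> i /=; case: ifP => [/IH //|_]; apply: ldvd0.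
have fg : eqm n.+1 f g by move=> i /= ->.
have g0 : g 0%N = 1 by [].
have := @coefX_diff f g n.+1 b isT f0 g0 fg; rewrite /g /= ltnn subr0 -/g => e.
apply: (ldvd_cancel pl lb); rewrite -e.
exact: (lintB hb (lintX b hg)).
Qed.

(** The power [(q; q)_oo^a], in the unscaled variable. *)
Definition powq (a : rat) := Fps (fps_powr qpoch a).

Lemma powq0 a : powq a 0%N = 1. Proof. exact: fps_powr_coef0. Qed.

Lemma powqD a b : powq (a + b) = powq a * powq b.
Proof. by apply: fpsP => n; rewrite /= fps_powrD // qpoch0. Qed.

Lemma powq_nat d : powq d%:R = euler ^+ d.
Proof.
apply: fpsP => n; rewrite fcoefX /= -[d%:R]/(1 *+ d) fps_powrMn ?qpoch0 //.
by apply: eq_fps_exp; apply: fps_powr1; apply: qpoch0.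
Qed.

Lemma powqX a b : powq a ^+ b = powq (a *+ b).
Proof. by apply: fpsP => n; rewrite fcoefX /= fps_powrMn ?qpoch0. Qed.

Lemma powq_numq a : powq a ^+ absz (denq a) = powq (numq a)%:~R.
Proof. by rewrite powqX mulrn_denq. Qed.

Lemma lint_powq_int (a : int) : lint (powq a%:~R).
Proof.
case: a => a; first by rewrite powq_nat; apply: lintX; apply: lint_euler.
rewrite NegzE; set b := a.+1.
have e : powq (- b%:Z)%:~R * euler ^+ b = 1.
  by rewrite -powq_nat -powqD rmorphN /= addNr; apply: fpsP => n; rewrite /= fps_powr0.
have -> : powq (- b%:Z)%:~R = fps_inv euler ^+ b; last by apply: lintX;
  apply: lint_inv; apply: lint_euler.
transitivity (powq (- b%:Z)%:~R * (euler * fps_inv euler) ^+ b).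
  by rewrite fps_mulfV ?euler0 // expr1n mulr1.
by rewrite exprMn mulrA e mul1r.
Qed.

Lemma lint_powq a : ~~ (l %| absz (denq a))%N -> lint (powq a).
Proof.
by move=> h; apply: (lint_root h (powq0 a)); rewrite powq_numq; apply: lint_powq_int.
Qed.

Lemma der_powq_int (a : int) : euler * D (powq a%:~R) = a%:~R * (powq a%:~R * D euler).
Proof.
have nat_case n : euler * D (euler ^+ n) = n%:R * (euler ^+ n * D euler).
  by rewrite derX; case: n => [|n]; rewrite ?mul0r ?mulr0 // exprS /=; ring.
case: a => a; first by rewrite powq_nat nat_case.
rewrite NegzE; set b := a.+1; set f := powq _.
have e : f * euler ^+ b = 1.
  by rewrite -powq_nat -powqD rmorphN /= addNr; apply: fpsP => n; rewrite /= fps_powr0.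
have nz : euler ^+ b != 0 by apply: fps_expf_neq0; apply: (@fps_neq0 _ 0);
  rewrite euler0 oner_neq0.
have := congr1 D e; rewrite derM der1 => e'.
apply: (fps_mulfI nz) => /=.
transitivity (euler * (D f * euler ^+ b
  + f * D (euler ^+ b)) - f * (euler * D (euler ^+ b))); first by ring.
by rewrite e' nat_case rmorphN /= -[b%:Z%:~R]/(b%:R); ring.
Qed.

(** The equation [D (f^a) * f = a * f^a * D f], obtained from integral
    exponents by taking the power with exponent the denominator of [a]. *)
Lemma der_powq a : (absz (denq a))%:R * (euler * D (powq a))
  = (numq a)%:~R * (powq a * D euler).
Proof.
have := der_powq_int (numq a); rewrite -powq_numq; set b := absz (denq a).
have b0 : (0 < b)%N by rewrite /b absz_gt0 denq_neq0.
move: b0; case: b => // b _; rewrite derX /= => e.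
have nz : powq a ^+ b != 0 by apply: fps_expf_neq0; apply: (@fps_neq0 _ 0);
  rewrite powq0 oner_neq0.
apply: (fps_mulfI nz) => /=.
transitivity (euler * (b.+1%:R * powq a ^+ b * D (powq a))); first by ring.
by rewrite e exprS; ring.
Qed.

(** Integrality of the logarithmic derivative of [(q; q)_oo] shows that the
    coefficients of [D (f^a)] are divisible by the numerator of [a], as far as
    [l] is concerned. *)
Lemma powq_bound a m n : ~~ (l %| absz (denq a))%N -> (l%:Z ^+ m %| numq a)%Z ->
  ldvd l m (n%:R * powq a n).
Proof.
move=> lb la; apply: (ldvd_cancel pl lb).
have e : (absz (denq a))%:R * D (powq a)
  = (numq a)%:~R * (fps_inv euler * (powq a * D euler)).
  transitivity (euler * fps_inv euler * ((absz (denq a))%:R * D (powq a))).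
    by rewrite fps_mulfV ?mul1r ?euler0.
  transitivity (fps_inv euler * ((absz (denq a))%:R * (euler * D (powq a))));
    first by ring.
  by rewrite der_powq; ring.
have := congr1 (fun f : fps => f n) e;
  rewrite fcoef_natl mulrzl fcoefMz -mulrzl [D _ n]/= => ->.
rewrite -[m]addn0; apply: ldvdM => //; first exact: ldvd_intM.
apply: lintM; first by apply: lint_inv; apply: lint_euler.
by apply: lintM; [apply: lint_powq | apply: lint_der; apply: lint_euler].
Qed.

Lemma ldvd_ord m x : ldvd l m x -> x != 0 ->
  (m + logn l (absz (denq x)) <= logn l (absz (numq x)))%N.
Proof.
move=> [a [b [lb e]]] x0.
have bz : b%:R != 0 :> rat by apply: contraNneq lb => /eqP; rewrite pnatr_eq0 => /eqP ->.
have a0 : a != 0.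
  apply: contra_neq x0 => az; apply: (mulfI bz); rewrite e az !mulr0 //.
have ez : b%:Z * numq x = (l ^ m)%N%:Z * a * denq x.
  apply: (@intr_inj rat); rewrite !rmorphM /= -[b%:Z%:~R]/(b%:R) -[(l ^
    m)%N%:Z%:~R]/((l ^ m)%:R).
  by rewrite -e -mulrA numqE.
have b0 : (0 < b)%N by rewrite lt0n; apply: contraNneq lb => ->.
have := congr1 (fun z => logn l (absz z)) ez; rewrite !abszM /=.
rewrite !lognM ?muln_gt0 ?expn_gt0 ?(prime_gt0 pl) ?absz_gt0 ?numq_eq0 ?denq_neq0 ?a0 //.
rewrite pfactorK // [logn l b]lognE (negbTE lb) !andbF add0n => ->.
by rewrite -addnA leq_add2l leq_addl.
Qed.

Lemma ldvd0_denq x : ldvd l 0 x -> ~~ (l %| absz (denq x))%N.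
Proof.
move=> h; have [->|x0] := eqVneq x 0; first by rewrite dvdn1 gtn_eqF ?prime_gt1.
apply/negP => ld; have := ldvd_ord h x0; have cop := coprime_num_den x.
have : (0 < logn l (absz (denq x)))%N by rewrite logn_gt0 mem_primes pl ld absz_gt0
  denq_neq0.
rewrite add0n => h1 h2; have : (0 < logn l (absz (numq x)))%N by apply: leq_trans h2.
rewrite logn_gt0 mem_primes => /and3P[_ _ ln].
have : (l %| 1)%N by rewrite -(eqP cop) dvdn_gcd ln ld.
by rewrite dvdn1 gtn_eqF ?prime_gt1.
Qed.

Lemma denq_ldvd0 x : ~~ (l %| absz (denq x))%N -> ldvd l 0 x.
Proof. by move=> h; exists (numq x), (absz (denq x));
  rewrite mul1r mulr_natl mulrn_denq. Qed.

Lemma ldvd_le_ord m x : ldvd l m x -> (m%:Z%:E <= ord l x)%E.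
Proof.
move=> h; rewrite /ord; have [e|x0] := eqVneq x 0; first by rewrite leEereal /=.
rewrite lee_fin; have := ldvd_ord h x0; lia.
Qed.

End Integrality.

(** * The congruence *)

Lemma powq_eta d i : powq d%:R i = (eta ^+ d) (24 * i + d)%N.
Proof.
rewrite powq_nat /eta exprMn monoX -VX // fcoef_monoM mul1n leq_addl addnK.
by rewrite mulnC V_coef.
Qed.

Lemma satisfactory_gt4 d l : satisfactory d l -> prime l /\ (4 < l)%N.
Proof. by move=> /andP[pl h]; split=> //; have := prime_gt1 pl; lia. Qed.

Lemma powq_vanish d l i : d \in [:: 4; 6; 8; 10; 14; 26]%N -> satisfactory d l ->
  (l %| 24 * i + d)%N -> ~~ (l ^ 2 %| 24 * i + d)%N -> powq d%:R i = 0.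
Proof.
by move=> hd sat h1 h2; rewrite powq_eta; have [h _] := inert_eta hd sat h1; apply: h.
Qed.

(** Termwise in [p_alpha(k) = sum_j p_beta(j) p_d(k - j)], according to the
    power of [l] in [j]: if [l] does not divide [j], the first factor is
    divisible by [l^m]; if [l] divides [j] exactly once, the first factor is
    divisible by [l^(m - 1)] and the second by [l]; if [l^2] divides [j], the
    second factor is zero. *)
Lemma ldvd_coef d l (alpha : rat) k m : d \in [:: 4; 6; 8; 10; 14;
  26]%N -> satisfactory d l ->
  ~~ (l %| absz (denq (alpha - d%:R)))%N -> (l%:Z ^+ m %| numq (alpha - d%:R))%Z ->
  (l %| 24 * k + d)%N -> ~~ (l ^ 2 %| 24 * k + d)%N ->
  ldvd l m (powq alpha k).
Proof.
move=> hd sat; have [pl l4] := satisfactory_gt4 sat.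
set beta := alpha - d%:R => lden lnum lk llk.
have cop : coprime l 24.
  by rewrite prime_coprime // ndvd_small //=; lia.
rewrite (_ : alpha = beta + d%:R); last by rewrite subrK.
rewrite powqD fcoefM; apply: ldvd_sum => // j _.
move: (nat_of_ord j) (ltn_ord j) => {}j; rewrite ltnS => jk.
have Nj : (24 * k + d = 24 * j + (24 * (k - j) + d))%N by lia.
have pd := @lint_powq l pl d%:R; rewrite -[d%:R]/(d%:Z%:~R) denq_int dvdn1 gtn_eqF
  ?prime_gt1 // in pd.
have {}pd := pd isT.
have pb := powq_bound pl j lden lnum.
have [lj|lj] := boolP (l %| j)%N; last first.
  by rewrite -[m]addn0; apply: ldvdM => //; exact: (ldvd_cancel pl lj pb).
have lkj : (l %| 24 * (k - j) + d)%N.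
  by move: lk; rewrite Nj dvdn_addr // dvdn_mull.
have [llj|llj] := boolP (l ^ 2 %| j)%N.
  rewrite (@powq_vanish d l) ?mulr0 //; first exact: ldvd0.
  by apply: contra llk => h; rewrite Nj dvdn_add // dvdn_mull.
have [_ d1] := inert_eta hd sat lkj; rewrite -powq_eta in d1.
case: m pb {lnum} => [|m] pb.
  by apply: (@ldvdM l pl 0 0) => //; apply: lint_powq.
rewrite -addn1; apply: ldvdM => //.
(* here [l] divides [j] exactly once: one factor [l] of [pb] is used up by [j] *)
have [j' e] := dvdnP lj; have lj' : ~~ (l %| j')%N.
  by apply: contra llj => h; rewrite e expnS expn1 dvdn_mul.
apply: (ldvd_cancel pl lj'); have [a [b [lb e1]]] := pb.
exists a, b; split=> //.
have lnz : l%:R != 0 :> rat by rewrite pnatr_eq0 -lt0n prime_gt0.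
apply: (mulfI lnz); transitivity (b%:R * (j%:R * powq beta j)).
  by rewrite [in LHS]e e natrM; ring.
by rewrite e1 expnS natrM; ring.
Qed.

Theorem theorem2 (d l : nat) (alpha : rat) (r : int)
    (hd : d \in [:: 4; 6; 8; 10; 14; 26]%N)
    (hl : satisfactory d l)
    (halpha : ~~ (l %| `|denq alpha|)%N)
    (hr : ord l (((24 %/ gcdn d 24)%N%:Z * r + (d %/ gcdn d 24)%N%:Z)%:~R : rat)
          = 1%:E)
    (n : int) :
  (ord l (alpha - d%:R) <= ord l (p_ alpha (l%:Z ^+ 2 * n + r)))%E.
Proof.
have [pl l4] := satisfactory_gt4 hl.
case E : (l%:Z ^+ 2 * n + r) => [k|k] /=; last by rewrite [ord l 0]/ord eqxx leey.
set g := gcdn d 24 in hr; set M := _ + _ in hr.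
have lg : ~~ (l %| g)%N.
  apply/negP => /dvdn_trans /(_ (dvdn_gcdr d 24)); apply/negP.
  by rewrite ndvd_small //=; lia.
have [lM llM] : (l %| absz M)%N /\ ~~ (l ^ 2 %| absz M)%N.
  move: hr; rewrite /ord intr_eq0; case: eqVneq => // M0.
  rewrite numq_int denq_int logn1 subr0 => -[e1].
  by rewrite -[X in (X %| _)%N]expn1 !pfactor_dvdn ?absz_gt0 // e1.
have eN : (24 * k + d)%N%:Z = g%:Z * (M + (24 %/ g)%N%:Z * n * l%:Z ^+ 2).
  have g24 : (g * (24 %/ g) = 24)%N by rewrite mulnC divnK // dvdn_gcdr.
  have gd : (g * (d %/ g) = d)%N by rewrite mulnC divnK // dvdn_gcdl.
  transitivity ((g * (24 %/ g))%N%:Z * (l%:Z ^+ 2 * n + r) + (g * (d %/ g))%N%:Z).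
    by rewrite g24 gd E PoszD PoszM.
  by rewrite /M !PoszM; ring.
have dvdN j : (j <= 2)%N -> (l ^ j %| 24 * k + d)%N = (l ^ j %| absz M)%N.
  move=> j2; rewrite -[(24 * k + d)%N]/(absz (24 * k + d)%N%:Z) eN abszM /=.
  rewrite Gauss_dvdr; last by apply: coprimeXl; rewrite prime_coprime.
  have lj : ((l ^ j)%N%:Z %| (24 %/ g)%N%:Z * n * l%:Z ^+ 2)%Z.
    by apply: dvdz_mull; rewrite -[l%:Z ^+ 2](sqr_absz l) dvdzE /= dvdn_exp2l.
  exact: (rpredDr M lj).
have lk : (l %| 24 * k + d)%N by have := dvdN 1%N isT; rewrite !expn1 lM.
have llk : ~~ (l ^ 2 %| 24 * k + d)%N by rewrite (dvdN 2%N).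
have lden : ~~ (l %| absz (denq (alpha - d%:R)))%N.
  apply: ldvd0_denq => //; apply: ldvdD => //; first exact: denq_ldvd0.
  by rewrite -[d%:R]/(d%:Z%:~R) -rmorphN; apply: ldvd_int.
have key m : (l%:Z ^+ m %| numq (alpha - d%:R))%Z ->
    (m%:Z%:E <= ord l (fps_powr qpoch alpha k))%E.
  by move=> h; apply: ldvd_le_ord => //; apply: (ldvd_coef hd hl lden h).
rewrite {1}/ord; case: eqVneq => [e|nz].
  have -> : alpha = d%:R by apply/eqP; rewrite -subr_eq0 e.
  by rewrite -[fps_powr _ _ _]/(powq d%:R k) (powq_vanish hd hl lk llk) /ord eqxx.
have -> : logn l (absz (denq (alpha - d%:R))) = 0%N.
  by rewrite lognE (negbTE lden) !andbF.
rewrite subr0; apply: key.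
rewrite dvdzE abszX /=; exact: pfactor_dvdnn.
Qed.
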